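(* Let $R\subseteq S$ be an étale ring extension. (1) $R\subseteq S$ has FIP, is seminormal and is finite if and only if its nucleus $R/(R:S)$ is Artinian and reduced. (2) $R\subseteq S$ has FIP, is finite and has reduced nucleus if and only if $R\subseteq S$ is a seminormal Gilmer extension.
   Context: Rings are commutative with identity. Étale: flat, of finite presentation, unramified. $(R:S)=\{r\in R\mid rS\subseteq R\}$, nucleus $R/(R:S)$; Gilmer extension: nucleus Artinian. Seminormal: $b\in S$, $b^2,b^3\in R$ imply $b\in R$. FIP: finitely many $R$-subalgebras. *)

(* Defs.v *)
From HB Require Import structures.
From mathcomp Require Import all_boot all_order all_algebra.
From mathcomp Require Import mpoly.
Set Implicit Arguments. Unset Strict Implicit. Unset Printing Implicit Defensive.
Import GRing.Theory.
Local Open Scope ring_scope.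

(* A ring extension R ⊆ S is modelled by an injective ring morphism
   f : R -> S between commutative rings; "elements of R" inside S are the
   elements of the image of f. *)

Section Ext.
Variables (R S : comNzRingType) (f : {rmorphism R -> S}).

Definition inR (s : S) : Prop := exists r : R, f r = s.

Definition finite_ext : Prop :=
  exists (n : nat) (g : 'I_n -> S),
    forall s : S, exists c : 'I_n -> R, s = \sum_(i < n) f (c i) * g i.

Definition subalgebra (T : S -> Prop) : Prop :=
  [/\ forall r : R, T (f r),
      forall x y, T x -> T y -> T (x - y),
      forall x y, T x -> T y -> T (x * y) & T 1].

Definition FIP : Prop :=
  exists (n : nat) (F : 'I_n -> (S -> Prop)),
    forall T, subalgebra T -> exists i : 'I_n, forall x, T x <-> F i x.

Definition seminormal : Prop :=
  forall b : S, inR (b ^+ 2) -> inR (b ^+ 3) -> inR b.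

Definition conductor (r : R) : Prop := forall s : S, inR (f r * s).

Definition ideal (I : R -> Prop) : Prop :=
  [/\ I 0, forall x y, I x -> I y -> I (x + y)
           & forall a x, I x -> I (a * x)].

(* The nucleus R/(R:S) is Artinian: DCC on ideals of R/(R:S), i.e. on
   ideals of R containing (R:S). *)
Definition nucleus_artinian : Prop :=
  forall J : nat -> (R -> Prop),
    (forall n, ideal (J n)) ->
    (forall n r, conductor r -> J n r) ->
    (forall n r, J n.+1 r -> J n r) ->
    exists N, forall n, (N <= n)%N -> forall r, J n r <-> J N r.

Definition nucleus_reduced : Prop :=
  forall (r : R) (k : nat), conductor (r ^+ k) -> conductor r.

Definition gilmer : Prop := nucleus_artinian.

(* Flatness of S as an R-module (equational criterion). *)
Definition flat_ext : Prop :=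
  forall (n : nat) (r : 'I_n -> R) (s : 'I_n -> S),
    \sum_(i < n) f (r i) * s i = 0 ->
    exists (m : nat) (a : 'I_n -> 'I_m -> R) (t : 'I_m -> S),
      (forall i, s i = \sum_(j < m) f (a i j) * t j) /\
      (forall j, \sum_(i < n) r i * a i j = 0).

Definition fin_pres : Prop :=
  exists (n : nat) (v : 'I_n -> S) (k : nat) (g : 'I_k -> {mpoly R[n]}),
    (forall s : S, exists p : {mpoly R[n]}, mmap f v p = s) /\
    (forall p : {mpoly R[n]}, mmap f v p = 0 <->
       exists q : 'I_k -> {mpoly R[n]}, p = \sum_(i < k) q i * g i).

Definition fin_type : Prop :=
  exists (n : nat) (v : 'I_n -> S),
    forall s : S, exists p : {mpoly R[n]}, mmap f v p = s.

Definition R_derivation (M : lmodType S) (D : S -> M) : Prop :=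
  [/\ forall x y, D (x + y) = D x + D y,
      forall x y, D (x * y) = x *: D y + y *: D x
    & forall r : R, D (f r) = 0].

(* Unramified: finite type and Ω_{S/R} = 0, i.e. (universal property of
   Kähler differentials) every R-derivation of S into any S-module is 0. *)
Definition unramified : Prop :=
  fin_type /\
  forall (M : lmodType S) (D : S -> M), R_derivation D -> forall x, D x = 0.

Definition etale : Prop := [/\ flat_ext, fin_pres & unramified].

End Ext.

(* Main.v *)
Require Import Defs.
From HB Require Import structures.
From mathcomp Require Import all_boot all_order all_algebra.
From mathcomp Require Import perm mpoly ring ring_quotient generic_quotient.
From mathcomp Require Import boolp.
From mathcomp Require classical_sets.

(** Let C be the conductor (R : S).

    If the extension is finite with FIP, the chains of subalgebras R + r^k S and
    R + JS are stationary.  Nakayama's lemma for S/R then shows that a reduced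
    nucleus is von Neumann regular, and that its ideals satisfy the descending
    chain condition.

    Conversely, if R/C is Artinian and reduced, it is a finite product of fields,
    and everything reduces to an algebra A over a field F with zero differentials.
    Let I be the kernel of the multiplication A (x) A -> A.  Then I = I^2, and the
    determinant trick gives E in A (x) A killed by all a (x) 1 - 1 (x) a and with
    product 1.  Writing E with independent left factors shows that A is finite and
    reduced.  A subalgebra T is a finite product of fields; applying T-linear maps
    A -> T to both sides of E gives an analogous element E_T in T (x) T, which is
    idempotent in A (x) A and determines T as the set of a with
    (a (x) 1 - 1 (x) a) E_T = 0.  As A (x) A is finite over F, it has finitely many
    idempotents, whence FIP. *)

Set Implicit Arguments.
Unset Strict Implicit.
Unset Printing Implicit Defensive.
Import GRing.Theory.
Local Open Scope ring_scope.

(** * Quotients by ideals and descending families *)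

Lemma quotient_ring (P : comNzRingType) (I : P -> Prop) :
  ideal I -> ~ I 1 ->
  exists (Q : comNzRingType) (q : {rmorphism P -> Q}),
    (forall y, exists x, q x = y) /\ (forall x, q x = 0 <-> I x).
Proof.
move=> [I0 ID IM] I1.
(* Excluded middle turns the ideal into the boolean predicate that the quotient construction
   expects; [~ I 1] keeps the quotient nonzero. *)
have clI : idealr_closed (fun x => `[< I x >]).
  split; first exact/asboolP.
  - by rewrite unfold_in; apply/asboolP.
  - move=> a x y /asboolP Ix /asboolP Iy; apply/asboolP.
    by apply: ID => //; exact: IM.
pose K : idealr P := HB.pack (fun x => `[< I x >]) (isIdealr.Build P _ clI).
exists {ideal_quot K}, (\pi_{ideal_quot K})%qT; split => [y|x].
  by exists (repr y); exact: reprK.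
rewrite -(rmorph0 (\pi_{ideal_quot K})%qT); split.
  by move/eqP; rewrite -Quotient.idealrBE subr0 => /asboolP.
by move=> Ix; apply/eqP; rewrite -Quotient.idealrBE subr0; apply/asboolP.
Qed.

Lemma descending_le (X : Type) (H : nat -> X -> Prop) :
  (forall n x, H n.+1 x -> H n x) -> forall m n x, (m <= n)%N -> H n x -> H m x.
Proof.
move=> Hdesc m n x /subnKC <-; elim: (n - m)%N x => [|d IH] x; first by rewrite addn0.
by rewrite addnS => /Hdesc /IH.
Qed.

(** * Determinants modulo an ideal *)

Section Determinant.
Variable R : comNzRingType.

Lemma ideal_sum (I : R -> Prop) (K : Type) (r : seq K) (F : K -> R) :
  ideal I -> (forall k, I (F k)) -> I (\sum_(k <- r) F k).
Proof. by case=> I0 ID _ IF; elim/big_ind: _ => // *; exact: ID. Qed.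

Lemma ideal_opp (I : R -> Prop) x : ideal I -> I x -> I (- x).
Proof. by case=> _ _ IM Ix; rewrite -mulN1r; exact: IM. Qed.

(** The products in the Leibniz expansion are congruent factor by factor. *)
Lemma det_congr (I : R -> Prop) (n : nat) (M N : 'M[R]_n) :
  ideal I -> (forall i j, I (M i j - N i j)) -> I (\det M - \det N).
Proof.
move=> idI IMN; have [I0 ID IM] := idI.
rewrite /determinant -sumrB; apply: ideal_sum => // s; rewrite -mulrBr; apply: (IM).
elim/big_rec2: _ => [|i y x _ Ixy]; first by rewrite subrr.
have -> : M i (s i) * x - N i (s i) * y
  = x * (M i (s i) - N i (s i)) + N i (s i) * (x - y) by ring.
by apply: (ID); apply: (IM) => //; have := ideal_opp idI Ixy; rewrite opprB.
Qed.

(** Cramer's rule: the system is multiplied by the adjugate. As [P] may be any [R]-submodule, this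
    covers both vanishing and membership in the image of [R]. *)
Lemma det_kills (V : comNzRingType) (f : {rmorphism R -> V}) (P : V -> Prop)
    (n : nat) (M : 'M[R]_n) (g : 'I_n -> V) :
  P 0 -> (forall x y, P x -> P y -> P (x + y)) ->
  (forall r x, P x -> P (f r * x)) ->
  (forall i, P (\sum_j f (M i j) * g j)) -> forall k, P (f (\det M) * g k).
Proof.
move=> P0 PD PM PMg k.
have -> : f (\det M) * g k
    = \sum_i f ((\adj M) k i) * \sum_j f (M i j) * g j.
  under eq_bigr do rewrite mulr_sumr.
  rewrite exchange_big /=.
  transitivity (\sum_j f ((\adj M *m M) k j) * g j).
    rewrite mul_adj_mx (bigD1 k) //= big1 => [|j jk].
      by rewrite addr0 mxE eqxx mulr1n.
    by rewrite mxE eq_sym (negbTE jk) mulr0n rmorph0 mul0r.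
  apply: eq_bigr => j _; rewrite mxE rmorph_sum mulr_suml.
  by apply: eq_bigr => i _; rewrite rmorphM mulrA.
by elim/big_ind: _ => // i _; exact: PM.
Qed.

End Determinant.

(** * Linear algebra over subfields cut out by idempotents *)

Section Subrings.
Variable A : comNzRingType.
Implicit Types T U V : A -> Prop.

Definition subring T : Prop :=
  [/\ T 1, forall x y, T x -> T y -> T (x - y)
         & forall x y, T x -> T y -> T (x * y)].

Definition submodule T V : Prop :=
  [/\ V 0, forall x y, V x -> V y -> V (x + y)
         & forall t x, T t -> V x -> V (t * x)].

Lemma subring0 T : subring T -> T 0.
Proof. by case=> T1 TB _; rewrite -(subrr 1); exact: TB. Qed.

Lemma subringN T x : subring T -> T x -> T (- x).
Proof.
move=> sT Tx; have [_ TB _] := sT; rewrite -sub0r.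
by apply: TB => //; exact: subring0.
Qed.

Lemma subringD T x y : subring T -> T x -> T y -> T (x + y).
Proof.
move=> sT Tx Ty; have [_ TB _] := sT; rewrite -[y]opprK.
by apply: TB => //; exact: subringN.
Qed.

Lemma subring_sum T (K : Type) (r : seq K) (F : K -> A) :
  subring T -> (forall k, T (F k)) -> T (\sum_(k <- r) F k).
Proof.
move=> sT TF; elim/big_ind: _ => //; first exact: subring0.
by move=> x y; exact: subringD.
Qed.

Lemma submoduleB T V x y : subring T -> submodule T V -> V x -> V y -> V (x - y).
Proof.
move=> sT [V0 VD VM] Vx Vy; rewrite -mulN1r; apply: (VD) => //; apply: (VM) => //.
by apply: subringN => //; case: sT.
Qed.

(* [e T] is a field with unit [e]. *)
Definition subfield T (e : A) : Prop :=
  [/\ T e, e * e = e, e <> 0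
    & forall t, T t -> e * t <> 0 -> exists2 u, T u & e * t * u = e].

(** [W] records the target: [W = T] gives [T]-valued functionals, and [fun=> True] gives
    endomorphisms of [A]. *)
Definition tlinear T (W : A -> Prop) (phi : A -> A) : Prop :=
  [/\ forall x y, phi (x + y) = phi x + phi y,
      forall t x, T t -> phi (t * x) = t * phi x & forall x, W (phi x)].

Lemma tlinear0 T W phi : tlinear T W phi -> phi 0 = 0.
Proof. by case=> pD _ _; apply: (addrI (phi 0)); rewrite -pD !addr0. Qed.

Lemma tlinear_sum T W phi (K : Type) (r : seq K) (F : K -> A) :
  tlinear T W phi -> phi (\sum_(k <- r) F k) = \sum_(k <- r) phi (F k).
Proof. by move=> pl; apply: (big_morph phi); [case: pl | exact: tlinear0 pl]. Qed.

(** By Zorn's lemma; [H] will be the kernel of a functional that separates [a] from [U]. *)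
Lemma maximal_avoiding T U (a : A) :
  submodule T U -> ~ U a ->
  exists H, [/\ submodule T H, forall x, U x -> H x, ~ H a
    & forall H', submodule T H' -> (forall x, H x -> H' x) ->
        ~ H' a -> forall x, H' x -> H x].
Proof.
move=> [U0 UD UM] Ua.
(* The empty set is admitted because it is the union of the empty chain. *)
pose P H := [/\ forall x y, H x -> H y -> H (x + y),
   forall t x, T t -> H x -> H (t * x),
   forall h, H h -> forall x, U x -> H x & ~ H a].
have [|H [[HD HM HU Ha] Hmax]] := @classical_sets.Zorn_bigcup A P.
  move=> F FP Ftot; split.
  - move=> x y [X FX Xx] [Y FY Yy].
    have [XY|YX] := Ftot X Y FX FY.
      by exists Y => //; have [YD _ _ _] := FP Y FY; apply: YD => //; exact: XY.
    by exists X => //; have [XD _ _ _] := FP X FX; apply: XD => //; exact: YX.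
  - by move=> t x Tt [X FX Xx]; exists X => //; have [_ XM _ _] := FP X FX; exact: XM.
  - by move=> h [X FX Xh] x Ux; exists X => //; have [_ _ XU _] := FP X FX; exact: XU Xh _ Ux.
  - by move=> [X FX Xa]; have [_ _ _] := FP X FX.
have maxH H' : P H' -> (forall x, H x -> H' x) -> forall x, H' x -> H x.
  move=> PH' HH' x H'x; apply: contrapT => nHx; apply: (Hmax H') => //; split => //.
  by move=> /(_ x H'x).
have [h Hh] : exists h, H h.
  apply: contrapT => nH; have HF x : ~ H x by move=> Hx; apply: nH; exists x.
  by apply: (HF 0); apply: (maxH U) => // x /HF.
have HUx : forall x, U x -> H x by exact: HU Hh.
exists H; split => //.
  by split => //; exact: HUx.
move=> H' [H'0 H'D H'M] HH' H'a; apply: maxH => //; split => // _ _ x Ux.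
by apply: HH'; exact: HUx.
Qed.

Lemma separating_functional T U e x :
  subring T -> subfield T e -> submodule T U -> ~ U (e * x) ->
  exists phi, [/\ tlinear T T phi, forall y, U y -> phi y = 0 & phi x = e].
Proof.
move=> sT [Te ee _ einv] sU Uex; have [T1 TB TM] := sT.
have [H [sH UH Hex Hmax]] := maximal_avoiding sU Uex.
have [H0 HD HM] := sH.
have ex a : exists c, [/\ T c, e * c = c & H (e * a - c * x)].
  have [Ha|nHa] := EM (H (e * a)).
    exists 0; split; rewrite ?mulr0 ?mul0r ?subr0 //; exact: subring0.
  (* By maximality [H + T e a] contains [e x], and the coefficient of [e a] there is invertible
     because [e x] is not in [H]. *)
  pose H' b := exists h t, [/\ H h, T t & b = h + t * (e * a)].
  have sH' : submodule T H'.
    split.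
    - by exists 0, 0; split => //; [exact: subring0 | rewrite mul0r addr0].
    - move=> _ _ [h [t [Hh Tt ->]]] [h' [t' [Hh' Tt' ->]]].
      exists (h + h'), (t + t'); split; [exact: HD|exact: subringD|ring].
    - move=> r _ Tr [h [t [Hh Tt ->]]]; exists (r * h), (r * t).
      by split; [exact: HM|exact: TM|ring].
  have [h [t [Hh Tt exE]]] : H' (e * x).
    apply: contrapT => nH'; apply: nHa; apply: (Hmax H') => //.
      by move=> y Hy; exists y, 0; split => //; [exact: subring0|rewrite mul0r addr0].
    by exists 0, 1; split => //; rewrite mul1r add0r.
  have [u Tu uE] : exists2 u, T u & e * t * u = e.
    apply: einv => // et0; apply: Hex; rewrite exE.
    by rewrite mulrCA mulrA et0 mul0r addr0.
  exists (e * u); split; [exact: TM|by rewrite mulrA ee|].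
  have -> : e * a - e * u * x = - u * h.
    have -> : h = e * x - t * (e * a) by rewrite exE; ring.
    by rewrite -{1}uE; ring.
  by apply: (HM) => //; exact: subringN.
(* A nonzero difference of two coefficients would be invertible in [e T] and force [e x] into
   [H]. *)
have uniq c c' y : T c -> e * c = c -> T c' -> e * c' = c' ->
    H (y - c * x) -> H (y - c' * x) -> c = c'.
  move=> Tc ec Tc' ec' Hc Hc'; apply: contrapT => cc'.
  have ed : e * (c - c') = c - c' by rewrite mulrBr ec ec'.
  have [u Tu uE] : exists2 u, T u & e * (c - c') * u = e.
    apply: einv; first exact: TB.
    by rewrite ed => /eqP; rewrite subr_eq0 => /eqP.
  apply: Hex; rewrite -uE ed.
  have -> : (c - c') * u * x = u * (y - c' * x - (y - c * x)) by ring.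
  by apply: (HM) => //; exact: (submoduleB sT sH).
have [phi phiP] := choice ex.
exists phi; split.
- split.
  + move=> a b; have [Ta ea Ha] := phiP a; have [Tb eb Hb] := phiP b.
    have [Tc ec Hc] := phiP (a + b).
    apply: (uniq _ _ (e * (a + b))) => //; first exact: subringD.
      by rewrite mulrDr ea eb.
    have -> : e * (a + b) - (phi a + phi b) * x
       = e * a - phi a * x + (e * b - phi b * x) by ring.
    exact: HD.
  + move=> t a Tt; have [Ta ea Ha] := phiP a; have [Tc ec Hc] := phiP (t * a).
    apply: (uniq _ _ (e * (t * a))) => //; first exact: TM.
      by rewrite mulrCA ea.
    have -> : e * (t * a) - t * phi a * x = t * (e * a - phi a * x) by ring.
    exact: HM.
  + by move=> a; have [] := phiP a.
- move=> y Uy; have [Tc ec Hc] := phiP y.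
  apply: (uniq _ _ (e * y)) => //; rewrite ?mulr0 ?mul0r ?subr0 //.
    exact: subring0.
  by apply: (HM) => //; exact: UH.
- have [Tc ec Hc] := phiP x; apply: (uniq _ _ (e * x)) => //.
  by rewrite subrr.
Qed.

(** Recursion on the list exposes the coefficient of the first generator, so that generators can be
    eliminated one at a time. *)
Fixpoint tspan T (K : Type) (g : K -> A) (s : seq K) (a : A) : Prop :=
  if s is k :: s' then exists2 t, T t & tspan T g s' (a - t * g k) else a = 0.

Lemma submodule_tspan T (K : Type) (g : K -> A) (s : seq K) :
  subring T -> submodule T (tspan T g s).
Proof.
move=> sT; have [T1 TB TM] := sT; elim: s => [|k s [S0 SD SM]] /=.
  by split => // [x y -> ->|t x _ ->]; rewrite ?addr0 ?mulr0.
split.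
- by exists 0; [exact: subring0 | rewrite mul0r subr0].
- move=> x y [t Tt xt] [u Tu yu]; exists (t + u); first exact: subringD.
  by have := SD _ _ xt yu; congr tspan; ring.
- move=> r x Tr [t Tt xt]; exists (r * t); first exact: TM.
  by have := SM _ _ Tr xt; congr tspan; ring.
Qed.

Lemma mem_tspan T (K : eqType) (g : K -> A) (s : seq K) k :
  subring T -> k \in s -> tspan T g s (g k).
Proof.
move=> sT; elim: s => // j s IH /=; rewrite inE => /orP[/eqP ->|ks].
  exists 1; first by case: sT.
  by rewrite mul1r subrr; have [] := submodule_tspan g s sT.
by exists 0; [exact: subring0 | rewrite mul0r subr0; exact: IH].
Qed.

Lemma submodule_sum T V (K : eqType) (r : seq K) (F : K -> A) :
  submodule T V -> (forall k, k \in r -> V (F k)) -> V (\sum_(k <- r) F k).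
Proof. by case=> V0 VD _ VF; rewrite big_seq; elim/big_ind: _ => //; exact: VD. Qed.

(** If a = sum t_i x_i, the x_i being the left factors of [s], then a (x) y = sum x_i (x) t_i y is
    absorbed by adding t_i y to the right factors. The list [s'] does not depend on [b], so it can
    be evaluated under several balanced maps. *)
Lemma tspan_merge T (s : seq (A * A)) a y :
  tspan T (fun k => k.1) s a ->
  exists s' : seq (A * A), map fst s' = map fst s /\
    forall (W : zmodType) (b : A -> A -> W),
      (forall x x' z, b (x + x') z = b x z + b x' z) ->
      (forall x z z', b x (z + z') = b x z + b x z') ->
      (forall t x z, T t -> b (t * x) z = b x (t * z)) ->
      \sum_(k <- s') b k.1 k.2 = b a y + \sum_(k <- s) b k.1 k.2.
Proof.
elim: s a => [a /= ->|k s IH a /= [t Tt /IH [s' [es' bs']]]].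
  exists nil; split=> // W b bDl _ _; rewrite !big_nil addr0.
  by apply: (addrI (b 0 y)); rewrite -bDl !addr0.
exists ((k.1, k.2 + t * y) :: s'); split; first by rewrite /= es'.
move=> W b bDl bDr bT; rewrite !big_cons bs' //= bDr -bT //.
rewrite -[in RHS](subrK (t * k.1) a) [b (_ + _ + _) _]bDl.
by rewrite addrACA [RHS]addrACA [X in X + _]addrC.
Qed.

Section TensorVanishing.
Variables (T : A -> Prop) (e : A).
Hypotheses (sT : subring T) (fT : subfield T e).
Variables (V : A -> Prop) (W : zmodType) (b : A -> A -> W) (Z : W -> Prop).
Hypothesis sV : submodule T V.
Hypothesis bDl : forall x y z, b (x + y) z = b x z + b y z.
Hypothesis bDr : forall x y z, b x (y + z) = b x y + b x z.
Hypothesis bT : forall t x y, T t -> b (t * x) y = b x (t * y).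
Hypothesis Z0 : Z 0.
Hypothesis ZD : forall x y, Z x -> Z y -> Z (x + y).

(* Under the hypotheses the tensor [sum x (x) e y] over [e T] can be rewritten
   with linearly independent left factors among the [x]'s, and then all its
   right factors lie in [V]. *)
Lemma tensor_vanishing (s : seq (A * A)) :
  (forall phi, tlinear T T phi -> V (\sum_(k <- s) phi k.1 * (e * k.2))) ->
  (forall x v, x \in map fst s -> V v -> Z (b x (e * v))) ->
  Z (\sum_(k <- s) b k.1 (e * k.2)).
Proof.
have [Te ee _ _] := fT; have [V0 VD VM] := sV; have [T1 TB TM] := sT.
have [n] := ubnP (size s); elim: n s => // n IH [_ _ _|k s]; first by rewrite big_nil.
rewrite ltnS /= => ltn HV HZ; rewrite big_cons.
(* A first factor dependent on the others is merged into them, which shortens the list; an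
   independent one is isolated by a functional. *)
have [/(tspan_merge k.2) [s' [es' bs']]|nspan] :=
    EM (tspan T (fun j : A * A => j.1) s (e * k.1)).
  have -> : b k.1 (e * k.2) + \sum_(j <- s) b j.1 (e * j.2)
      = \sum_(j <- s') b j.1 (e * j.2).
    rewrite (bs' W (fun x y => b x (e * y))) //=.
    - by rewrite bT // mulrA ee.
    - by move=> x z z'; rewrite mulrDr.
    - by move=> t x z Tt; rewrite bT // mulrCA.
  apply: IH.
  - by rewrite -(size_map fst) es' size_map.
  - move=> phi lphi; have [pD pM pT] := lphi.
    rewrite (bs' A (fun x y => phi x * (e * y))) //=.
    + have := HV phi lphi; rewrite big_cons; congr (V (_ + _)).
      by rewrite pM // -[in LHS]ee; ring.
    + by move=> x x' z; rewrite pD mulrDl.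
    + by move=> x z z'; rewrite !mulrDr.
    + by move=> t x z Tt; rewrite pM //; ring.
  - by move=> x v; rewrite es' => xs; apply: HZ; rewrite inE xs orbT.
have [phi [lphi phis phik]] :=
  separating_functional sT fT (submodule_tspan (fun j : A * A => j.1) s sT) nspan.
(* [phi] is [e] at the first left factor and zero at the others, so the hypothesis at [phi] reads
   off [e * k.2]. *)
have Vk : V (e * k.2).
  have := HV phi lphi; rewrite big_cons phik mulrA ee.
  rewrite big_seq big1 ?addr0 // => j js.
  by rewrite phis ?mul0r //; exact: (mem_tspan (fun j : A * A => j.1)).
apply: ZD.
  by rewrite -ee -mulrA; apply: HZ => //; rewrite inE eqxx.
apply: IH => //.
- move=> psi lpsi; have := HV psi lpsi; rewrite big_cons => Vs.
  rewrite -[X in V X](addKr (psi k.1 * (e * k.2))) addrC.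
  apply: (submoduleB sT sV) => //.
  by apply: (VM) => //; case: lpsi.
- by move=> x v xs; apply: HZ; rewrite inE xs orbT.
Qed.
End TensorVanishing.

(** * Descending chains and primitive idempotents *)

Section Chains.
Variable T : A -> Prop.
Hypothesis sT : subring T.

(** Gaussian elimination, by induction on the spanning list: the induction hypothesis handles the
    part of [H n] inside the span of the tail. *)
Lemma submodule_dcc (bs : seq A) (H : nat -> A -> Prop) :
  subfield T 1 -> (forall n, submodule T (H n)) ->
  (forall n x, H n.+1 x -> H n x) ->
  (forall n x, H n x -> tspan T id bs x) ->
  exists N, forall n, (N <= n)%N -> forall x, H N x -> H n x.
Proof.
move=> fT sH; have [_ _ _ inv] := fT; have [T1 TB TM] := sT.
elim: bs H sH => [|b bs IH] H sH Hdesc Hspan.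
  exists 0%N => n _ x /Hspan /= ->; by have [] := sH n.
have Hle := descending_le Hdesc.
have sp := submodule_tspan id bs sT; have [p0 pD pM] := sp.
pose G n x := H n x /\ tspan T id bs x.
have [||n x|N NP] := IH G.
- move=> n; have [H0 HD HM] := sH n; split=> //.
  + by move=> x y [Hx Bx] [Hy By]; split; [exact: HD|exact: pD].
  + by move=> t x Tt [Hx Bx]; split; [exact: HM|exact: pM].
- by move=> n x [/Hdesc Hx Bx].
- by case.
(* Either some [H M] lies in the span of the tail, or every [H n] has a pivot: an element [x] with
   invertible coefficient at [b], used to clear that of [y]. *)
have [[M MP]|nM] := EM (exists M, forall x, H M x -> tspan T id bs x).
  exists (maxn M N) => n le_n x Hx.
  have leN : (N <= n)%N by apply: leq_trans le_n; exact: leq_maxr.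
  suff [] : G n x by [].
  apply: NP => //; split; first by apply: Hle Hx; exact: leq_maxr.
  by apply: MP; apply: Hle Hx; exact: leq_maxl.
exists N => n le_n y Hy.
have [x Hx nx] : exists2 x, H n x & ~ tspan T id bs x.
  apply: contrapT => nx; apply: nM; exists n => x Hx; apply: contrapT => nsx.
  by apply: nx; exists x.
have /= [c Tc xc] := Hspan _ _ Hx; have /= [d Td yd] := Hspan _ _ Hy.
have [u Tu uE] : exists2 u, T u & 1 * c * u = 1.
  apply: inv => //; rewrite mul1r => c0; apply: nx.
  by move: xc; rewrite c0 mul0r subr0.
rewrite mul1r in uE.
have [] := NP n le_n (y - d * u * x).
  split; first by apply: (submoduleB sT (sH N)) => //; have [_ _ HM] := sH N;
    apply: HM; [exact: TM | exact: Hle Hx].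
  have -> : y - d * u * x = y - d * b - d * u * (x - c * b) + d * (1 - c * u) * b by ring.
  rewrite uE subrr mulr0 mul0r addr0; apply: (submoduleB sT sp) => //.
  by apply: (pM) => //; exact: TM.
move=> Hn _; rewrite -(subrK (d * u * x) y); have [_ HD HM] := sH n.
by apply: (HD) => //; apply: (HM) => //; exact: TM.
Qed.

(** One stationary step in every chain is equivalent to eventual stationarity, by passing to
    subchains. *)
Definition dcc : Prop := forall H : nat -> A -> Prop,
  (forall n, submodule T (H n)) -> (forall n x, H n x -> T x) ->
  (forall n x, H n.+1 x -> H n x) -> exists N, forall x, H N x -> H N.+1 x.

Hypothesis Tdcc : dcc.

Let principal (a : A) x := exists2 y, T y & x = a * y.

Let sub_principal a : T a -> submodule T (principal a).
Proof.
have [T1 TB TM] := sT; move=> Ta; split.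
- by exists 0; [exact: subring0 | rewrite mulr0].
- move=> _ _ [y Ty ->] [z Tz ->]; exists (y + z); first exact: subringD.
  by rewrite mulrDr.
- by move=> t _ Tt [y Ty ->]; exists (t * y); [exact: TM | rewrite mulrCA].
Qed.

(** The chain of the t^n T stops, so t^N = t^(N+1) y for some y; then t (1 - t y) is nilpotent,
    hence zero. *)
Lemma dcc_regular t :
  (forall (x : A) n, T x -> x ^+ n = 0 -> x = 0) -> T t ->
  exists2 u, T u & t = t * t * u.
Proof.
have [T1 TB TM] := sT; move=> Tred Tt.
have TX n : T (t ^+ n) by elim: n => [|n IH]; rewrite ?expr0 // exprS; exact: TM.
have [|n x [y Ty ->]|n x [y Ty ->]|N NP] := @Tdcc (fun n => principal (t ^+ n)).
- by move=> n; exact: sub_principal.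
- exact: TM.
- by exists (t * y); [exact: TM | rewrite exprSr mulrA].
have [|y Ty yE] := NP (t ^+ N); first by exists 1 => //; rewrite mulr1.
exists y => //; apply/eqP; rewrite -subr_eq0; apply/eqP.
have -> : t - t * t * y = t * (1 - t * y) by ring.
apply: (Tred _ N.+1); first by apply: (TM) => //; apply: (TB) => //; exact: TM.
have -> : (t * (1 - t * y)) ^+ N.+1
    = t * (1 - t * y) ^+ N * (t ^+ N - t ^+ N.+1 * y).
  by rewrite exprMn !exprS; ring.
by rewrite -yE subrr mulr0.
Qed.

Definition primitive_idem (e : A) : Prop :=
  [/\ T e, e * e = e, e <> 0
    & forall c, T c -> c * c = c -> c * e = 0 \/ c * e = e].

(** An idempotent that is not a sum of primitive ones splits in two, and one summand is again not
    such a sum. Iterating from 1 would give a strictly descending chain of principal ideals. *)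
Lemma idempotent_decomposition :
  exists2 l : seq A, \sum_(e <- l) e = 1 & forall e, e \in l -> primitive_idem e.
Proof.
have [T1 TB TM] := sT.
pose dec a := exists2 l : seq A, \sum_(e <- l) e = a
  & forall e, e \in l -> primitive_idem e.
pose bad a := [/\ T a, a * a = a & ~ dec a].
have split_bad a : bad a -> exists a', bad a /\ [/\ bad a', a' * a = a' & a' <> a].
  move=> bada; have [Ta aa nda] := bada.
  have a0 : a <> 0 by move=> a0; apply: nda; exists nil; rewrite ?big_nil.
  have [c [Tc cc ca0 caa]] : exists c, [/\ T c, c * c = c, c * a <> 0 & c * a <> a].
    apply: contrapT => nc; apply: nda; exists [:: a]; first by rewrite big_seq1.
    move=> e; rewrite inE => /eqP ->; split=> // c Tc cc.
    apply: contrapT => /not_orP[ca0 caa]; apply: nc; by exists c.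
  have idc : c * a * (c * a) = c * a by rewrite -[in RHS]aa -[in RHS]cc; ring.
  have caaE : c * a * a = c * a by rewrite -mulrA aa.
  have [dca|ndca] := EM (dec (c * a)).
    exists (a - c * a); split=> //; split.
    - split; first by apply: (TB) => //; exact: TM.
        by rewrite mulrBl !mulrBr idc aa [a * (c * a)]mulrC caaE subrr subr0.
      move=> [l2 l2E l2P]; apply: nda; case: dca => l1 l1E l1P.
      exists (l1 ++ l2); first by rewrite big_cat /= l1E l2E addrC subrK.
      by move=> e; rewrite mem_cat => /orP[/l1P|/l2P].
    - by rewrite mulrBl aa caaE.
    - by move=> E; apply: ca0; rewrite -[c * a](subKr a) E subrr.
  by exists (c * a); split=> //; split=> //; split => //; exact: TM.
apply: contrapT => nd1.
have bad1 : bad 1 by split; rewrite ?mulr1.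
have [nxt nxtP] : {nxt : A -> A & forall a, bad a ->
    [/\ bad (nxt a), nxt a * a = nxt a & nxt a <> a]}.
  apply: (@choice A A (fun a a' => bad a -> [/\ bad a', a' * a = a' & a' <> a])) => a.
  by have [/split_bad[a' [_ ?]]|nb] := EM (bad a); [exists a'|exists a].
pose e n := iter n nxt 1.
have bade n : bad (e n) by elim: n => //= n /nxtP [].
have [|n x [y Ty ->]|n x [y Ty ->]|N NP] := @Tdcc (fun n => principal (e n)).
- by move=> n; apply: sub_principal; have [] := bade n.
- by apply: (TM) => //; have [] := bade n.
- exists (e n.+1 * y); first by apply: (TM) => //; have [] := bade n.+1.
  by rewrite mulrA [e n * _]mulrC; have [_ -> _] := nxtP _ (bade n).
have [|y Ty yE] := NP (e N); first by exists 1 => //; rewrite mulr1.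
have [_ leN neN] := nxtP _ (bade N).
have [_ ee _] := bade N.+1.
have eN : e N.+1 * e N = e N by rewrite {1}yE mulrA ee -yE.
by apply: neN; rewrite -[RHS]eN.
Qed.

(** If x = e t is nonzero and x = x^2 u, then e x u = x u is a nonzero idempotent, and primitivity
    of [e] makes it equal to [e]. *)
Lemma primitive_subfield e :
  (forall t, T t -> exists2 u, T u & t = t * t * u) ->
  primitive_idem e -> subfield T e.
Proof.
have [T1 TB TM] := sT; move=> reg [Te ee e0 prim]; split=> // t Tt et0.
have [u Tu uE] := reg _ (TM _ _ Te Tt); exists u => //.
have idu : e * t * u * (e * t * u) = e * t * u by rewrite {3}uE; ring.
have [||E|E] := prim (e * t * u) => //; first by apply: (TM) => //; exact: TM.
- case: et0; rewrite uE.
  have -> : e * t * (e * t) * u = e * t * u * e * t by ring.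
  by rewrite E mul0r.
- by rewrite -[RHS]E -{1}ee; ring.
Qed.

End Chains.
End Subrings.

(** * Tensor square and separability element *)

Section TensorSquare.
Variables (R A : comNzRingType) (h : {rmorphism R -> A}).

Definition hlinear (phi : A -> A) : Prop := tlinear (inR h) (fun=> True) phi.

Lemma hlinear_id : hlinear id. Proof. by []. Qed.

Lemma hlinear_mul phi a : hlinear phi -> hlinear (fun x => phi (a * x)).
Proof.
move=> [pD pM _]; split=> // [x y|t x Rt]; first by rewrite mulrDr pD.
by rewrite mulrCA (pM t).
Qed.

Lemma subring_inR : subring (inR h).
Proof.
split; first by exists 1; rewrite rmorph1.
- by move=> _ _ [r <-] [s <-]; exists (r - s); rewrite rmorphB.
- by move=> _ _ [r <-] [s <-]; exists (r * s); rewrite rmorphM.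
Qed.

Section Evaluation.
Variables (n : nat) (w : 'I_n -> A) (phi : A -> A).
Hypothesis lphi : hlinear phi.

Lemma mmap_hlinearD (p q : {mpoly A[n]}) :
  mmap phi w (p + q) = mmap phi w p + mmap phi w q.
Proof.
have phiB : zmod_morphism phi.
  move=> x y; have [pD pM _] := lphi.
  by rewrite pD -mulN1r pM ?mulN1r //; exists (-1); rewrite rmorphN1.
pose psi : {additive A -> A} :=
  HB.pack phi (GRing.isZmodMorphism.Build A A phi phiB).
exact: (mmapD w psi).
Qed.

Lemma mmap_hlinear0 : mmap phi w 0 = 0.
Proof. by apply: (addrI (mmap phi w 0)); rewrite -mmap_hlinearD !addr0. Qed.

Lemma mmap_hlinear_sum (K : Type) (s : seq K) (F : K -> {mpoly A[n]}) :
  mmap phi w (\sum_(k <- s) F k) = \sum_(k <- s) mmap phi w (F k).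
Proof. exact: (big_morph _ mmap_hlinearD mmap_hlinear0). Qed.

Lemma mmap_hlinearZX (c : A) m : mmap phi w (c *: 'X_[m]) = phi c * mmap1 w m.
Proof.
have [->|c0] := eqVneq c 0.
  by rewrite scale0r mmap_hlinear0 (tlinear0 lphi) mul0r.
by rewrite /mmap msuppMCX // big_seq1 mcoeffZ mcoeffX eqxx mulr1.
Qed.

(** The polynomial [x p] with [p] over [R] stands for the tensor x (x) p(w); evaluating it applies
    [phi] to the left factor and multiplies. *)
Lemma mmap_hlinear_map (x : A) (p : {mpoly R[n]}) :
  mmap phi w (x%:MP * map_mpoly h p) = phi x * mmap h w p.
Proof.
rewrite {1}[p]mpolyE raddf_sum mulr_sumr mmap_hlinear_sum [mmap h w p]/mmap mulr_sumr.
apply: eq_bigr => m _ /=; rewrite map_mpolyZ map_mpolyX mul_mpolyC scalerA.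
have [_ pM _] := lphi.
by rewrite mmap_hlinearZX [x * _]mulrC pM; [ring | exists p@_m].
Qed.

End Evaluation.

(** This is why the polynomials killed by all linear [phi] form an ideal: the maps on the right are
    again linear. *)
Lemma mmap_hlinear_mul (n : nat) (w : 'I_n -> A) phi (p q : {mpoly A[n]}) :
  hlinear phi -> mmap phi w (p * q)
    = \sum_(m <- msupp p) mmap1 w m * mmap (fun x => phi (p@_m * x)) w q.
Proof.
move=> lphi; rewrite {1}[p]mpolyE mulr_suml mmap_hlinear_sum //.
apply: eq_bigr => m _; rewrite {1}[q]mpolyE mulr_sumr mmap_hlinear_sum //.
rewrite [X in _ = _ * X]/mmap mulr_sumr; apply: eq_bigr => m' _.
rewrite -scalerAl -scalerAr scalerA -mpolyXD mmap_hlinearZX //.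
by rewrite commr_mmap1_M => [|i x]; [ring | exact: mulrC].
Qed.

(* [B] is [A[X]] modulo the polynomials killed by all [R]-linear maps [phi];
   it is a quotient of the tensor square of [A] over [R], and the tensor square
   itself when [R] is a field. *)
Lemma tensor_square :
  Defs.fin_type h ->
  exists (B : comNzRingType) (lam rho : {rmorphism A -> B}),
    (forall b, exists s : seq (A * A), b = \sum_(k <- s) lam k.1 * rho k.2) /\
    (forall s : seq (A * A), \sum_(k <- s) lam k.1 * rho k.2 = 0 <->
       forall phi, hlinear phi -> \sum_(k <- s) phi k.1 * k.2 = 0).
Proof.
move=> [n [w wgen]].
pose Rel (q : {mpoly A[n]}) := forall phi, hlinear phi -> mmap phi w q = 0.
have idRel : ideal Rel.
  split=> [phi lphi|x y Rx Ry phi lphi|a x Rx phi lphi].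
  - exact: mmap_hlinear0.
  - by rewrite mmap_hlinearD // Rx // Ry // addr0.
  - rewrite mmap_hlinear_mul // big1 // => m _.
    by rewrite Rx ?mulr0 //; exact: hlinear_mul.
have nRel1 : ~ Rel 1.
  have E : (1 : {mpoly A[n]}) = 1%:MP * map_mpoly h 1.
    by rewrite !rmorph1 mulr1.
  move=> /(_ _ hlinear_id); rewrite E mmap_hlinear_map // rmorph1 mulr1 => /eqP.
  by rewrite oner_eq0.
have [B [q [qsurj qker]]] := quotient_ring idRel nRel1.
(* A right factor [a] is represented by a polynomial over [R] with value [a] at [w]; by [rE] the
   choice is immaterial in [B]. *)
have [lift liftP] := choice wgen.
pose r p := q (map_mpoly h p).
have rE p p' : mmap h w p = mmap h w p' -> r p = r p'.
  move=> pp'; apply/eqP; rewrite -subr_eq0 -rmorphB; apply/eqP/qker => phi lphi.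
  have -> : map_mpoly h p - map_mpoly h p' = 1%:MP * map_mpoly h (p - p').
    by rewrite mpolyC1 mul1r raddfB.
  by rewrite mmap_hlinear_map // raddfB /= pp' subrr mulr0.
pose lam a := q a%:MP; pose rho a := r (lift a).
have rhoE p : rho (mmap h w p) = r p by apply: rE; rewrite liftP.
have lamB : zmod_morphism lam by move=> x y; rewrite /lam !rmorphB.
have lamM : monoid_morphism lam.
  by split=> [|x y]; rewrite /lam ?rmorph1 ?rmorphM // mpolyC1 rmorph1.
have rhoB : zmod_morphism rho.
  move=> x y; rewrite -{1}(liftP x) -{1}(liftP y) -rmorphB rhoE.
  by rewrite /rho /r !rmorphB.
have rhoM : monoid_morphism rho.
  split=> [|x y].
    by rewrite -(rmorph1 (mmap h w)) rhoE /r !rmorph1.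
  by rewrite -{1}(liftP x) -{1}(liftP y) -rmorphM rhoE /rho /r !rmorphM.
pose lamR : {rmorphism A -> B} := HB.pack lam
  (GRing.isZmodMorphism.Build A B lam lamB) (GRing.isMonoidMorphism.Build A B lam lamM).
pose rhoR : {rmorphism A -> B} := HB.pack rho
  (GRing.isZmodMorphism.Build A B rho rhoB) (GRing.isMonoidMorphism.Build A B rho rhoM).
exists B, lamR, rhoR; split=> [b|s].
  have [p <-] := qsurj b.
  (* The monomial c X^m is the tensor c (x) w^m. *)
  exists [seq (p@_m, mmap1 w m) | m <- msupp p].
  rewrite big_map {1}[p]mpolyE rmorph_sum; apply: eq_bigr => m _ /=.
  rewrite -(mmapX w h) rhoE /r map_mpolyX /lam -rmorphM; congr (q _).
  by rewrite mul_mpolyC.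
have -> : \sum_(k <- s) lamR k.1 * rhoR k.2
    = q (\sum_(k <- s) k.1%:MP * map_mpoly h (lift k.2)).
  by rewrite rmorph_sum; apply: eq_bigr => k _; rewrite rmorphM.
have evE phi : hlinear phi ->
    mmap phi w (\sum_(k <- s) k.1%:MP * map_mpoly h (lift k.2))
    = \sum_(k <- s) phi k.1 * k.2.
  move=> lphi; rewrite mmap_hlinear_sum //; apply: eq_bigr => k _.
  by rewrite mmap_hlinear_map // liftP.
split=> [/qker H phi lphi|H]; first by rewrite -evE // H.
by apply/qker => phi lphi; rewrite evE // H.
Qed.

Lemma tensor_balanced (B : comNzRingType) (lam rho : {rmorphism A -> B}) :
  (forall s : seq (A * A), \sum_(k <- s) lam k.1 * rho k.2 = 0 <->
     forall phi, hlinear phi -> \sum_(k <- s) phi k.1 * k.2 = 0) ->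
  forall r, lam (h r) = rho (h r).
Proof.
move=> Bker r; have := (Bker [:: (h r, 1); (-1, h r)]).2.
rewrite !big_cons !big_nil /= rmorph1 mulr1 rmorphN1 mulN1r addr0.
move=> H; apply/eqP; rewrite -subr_eq0; apply/eqP/H => phi [pD pM _].
have ph1 : phi (-1) = - phi 1.
  by rewrite -mulN1r pM ?mulN1r //; exists (-1); rewrite rmorphN1.
have phr : phi (h r) = h r * phi 1.
  by rewrite -{1}[h r]mulr1 pM //; exists r.
by rewrite !big_cons !big_nil /= ph1 phr; ring.
Qed.

End TensorSquare.

(** * Derivations and the separability element *)

Lemma fin_type_ind (R S : comNzRingType) (f : {rmorphism R -> S}) n (v : 'I_n -> S)
    (P : S -> Prop) (p : {mpoly R[n]}) :
  (forall r, P (f r)) -> (forall i, P (v i)) ->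
  (forall x y, P x -> P y -> P (x + y)) ->
  (forall x y, P x -> P y -> P (x * y)) -> P (mmap f v p).
Proof.
move=> Pf Pv PD PM; rewrite /mmap.
have P1 : P 1 by rewrite -(rmorph1 f).
elim/big_ind: _; [by rewrite -(rmorph0 f) | exact: PD | move=> m _].
apply: (PM) => //; rewrite /mmap1; elim/big_ind: _; [by [] | exact: PM | move=> i _].
by elim: (m i) => [|k IH]; rewrite ?expr0 // exprS; exact: PM.
Qed.

(** A separate name for [Q], on which restriction of scalars along [g] is declared as the [S]-module
    structure; it is the target of a derivation below. *)
Definition pullback (S Q : comNzRingType) (g : {rmorphism S -> Q}) : Type := Q.

Section Pullback.
Variables (S Q : comNzRingType) (g : {rmorphism S -> Q}).

HB.instance Definition _ := GRing.Zmodule.copy (pullback g) Q.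

Let act (s : S) (x : pullback g) : pullback g := g s * (x : Q).

Let actA a b x : act a (act b x) = act (a * b) x.
Proof. by rewrite /act rmorphM mulrA. Qed.
Let act1 : left_id 1 act.
Proof. by move=> x; rewrite /act rmorph1 mul1r. Qed.
Let actDr : right_distributive act +%R.
Proof. by move=> a x y; exact: mulrDr. Qed.
Let actDl x : {morph act^~ x : a b / a + b}.
Proof. by move=> a b; rewrite /act rmorphD; exact: mulrDl. Qed.

HB.instance Definition _ :=
  GRing.Zmodule_isLmodule.Build S (pullback g) actA act1 actDr actDl.

End Pullback.

Section Separability.
Variables (R S A : comNzRingType) (f : {rmorphism R -> S}) (q : {rmorphism S -> A}).
Hypothesis qsurj : forall a, exists s, q s = a.
Hypothesis unr : unramified f.

Lemma fin_type_quotient : Defs.fin_type (q \o f).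
Proof.
have [[n [v vgen]] _] := unr; exists n, (q \o v) => a.
have [s <-] := qsurj a; have [p <-] := vgen s; exists p.
rewrite /mmap rmorph_sum; apply: eq_bigr => m _; rewrite rmorphM /=.
by congr (_ * _); rewrite /mmap1 rmorph_prod; apply: eq_bigr => i _; rewrite rmorphXn.
Qed.

(** Modulo I^2, the map sending [s] to q s (x) 1 - 1 (x) q s is an [R]-derivation, so it vanishes
    and I = I^2. The determinant trick then yields an element that is 1 modulo I and kills I. *)
Lemma separability_element (B : comNzRingType) (lam rho : {rmorphism A -> B}) :
  (forall b, exists s : seq (A * A), b = \sum_(k <- s) lam k.1 * rho k.2) ->
  (forall s : seq (A * A), \sum_(k <- s) lam k.1 * rho k.2 = 0 <->
     forall phi, hlinear (q \o f) phi -> \sum_(k <- s) phi k.1 * k.2 = 0) ->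
  exists s : seq (A * A), \sum_(k <- s) k.1 * k.2 = 1 /\
    forall a, (lam a - rho a) * (\sum_(k <- s) lam k.1 * rho k.2) = 0.
Proof.
move=> Bgen Bker; have [[n [v vgen]] der] := unr.
have lamrho := tensor_balanced Bker.
have [mu0 mu0P] := choice Bgen.
(* Multiplication [B -> A], computed on a chosen representation; [muE] shows independence of the
   choice, by the kernel criterion at the identity map. *)
pose mu b := \sum_(k <- mu0 b) k.1 * k.2.
have muE (s : seq (A * A)) :
    mu (\sum_(k <- s) lam k.1 * rho k.2) = \sum_(k <- s) k.1 * k.2.
  set b := (X in mu X); apply/eqP; rewrite -subr_eq0; apply/eqP.
  have := (Bker (mu0 b ++ [seq (- k.1, k.2) | k <- s])).1.
  rewrite !big_cat /= !big_map /= -mu0P.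
  have -> : \sum_(k <- s) lam (- k.1) * rho k.2 = - b.
    by rewrite -sumrN; apply: eq_bigr => k _; rewrite rmorphN mulNr.
  rewrite subrr => /(_ erefl _ (hlinear_id _)); rewrite big_cat big_map /= => E.
  rewrite -[RHS]E; congr (_ + _).
  by rewrite -sumrN; apply: eq_bigr => k _; rewrite mulNr.
have muD b c : mu (b + c) = mu b + mu c.
  have [s ->] := Bgen b; have [t ->] := Bgen c.
  by rewrite !muE -!big_cat muE.
have mu0' : mu 0 = 0 by apply: (addrI (mu 0)); rewrite -muD !addr0.
have muZ b a : mu (b * (lam a - rho a)) = 0.
  have [s ->] := Bgen b.
  have -> : (\sum_(k <- s) lam k.1 * rho k.2) * (lam a - rho a) =
    \sum_(k <- [seq (k.1 * a, k.2) | k <- s] ++ [seq (- k.1, k.2 * a) | k <- s])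
        lam k.1 * rho k.2.
    rewrite big_cat !big_map /= mulr_suml -big_split /=; apply: eq_bigr => k _.
    by rewrite !rmorphM rmorphN; ring.
  rewrite muE big_cat !big_map /= -big_split big1 //= => k _; ring.
have mu1 : mu 1 = 1.
  have -> : 1 = \sum_(k <- [:: (1 : A, 1 : A)]) lam k.1 * rho k.2.
    by rewrite big_seq1 !rmorph1 mulr1.
  by rewrite muE big_seq1 mulr1.
pose z i := lam (q (v i)) - rho (q (v i)).
pose I b := exists c : 'I_n -> B, b = \sum_i c i * z i.
have idI : ideal I.
  split.
  - by exists (fun=> 0); rewrite big1 // => i _; rewrite mul0r.
  - move=> _ _ [c ->] [d ->]; exists (fun i => c i + d i).
    by rewrite -big_split; apply: eq_bigr => i _; rewrite mulrDl.
  - move=> a _ [c ->]; exists (fun i => a * c i).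
    by rewrite mulr_sumr; apply: eq_bigr => i _; rewrite mulrA.
have [I0 ID IM] := idI.
have Iz i : I (z i).
  exists (fun j => (j == i)%:R); rewrite (bigD1 i) //= eqxx mul1r big1 ?addr0 //.
  by move=> j /negbTE ->; rewrite mul0r.
have Idiff a : I (lam a - rho a).
  have [s <-] := qsurj a; have [p <-] := vgen s.
  apply: (@fin_type_ind _ _ f n v (fun x => I (lam (q x) - rho (q x)))) => //.
  - by move=> r; rewrite [lam _]lamrho subrr.
  - move=> x y Ix Iy; have := ID _ _ Ix Iy; congr I; rewrite !rmorphD; ring.
  - move=> x y Ix Iy; have := ID _ _ (IM (lam (q y)) _ Ix) (IM (rho (q x)) _ Iy).
    congr I; rewrite !rmorphM; ring.
have muI b : I b -> mu b = 0.
  move=> [c ->]; rewrite (big_morph mu muD mu0') big1 // => i _; exact: muZ.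
(* [N] is I^2, written on the generators [z i] of I. *)
pose N b := exists2 c : 'I_n -> B, forall i, I (c i) & b = \sum_i c i * z i.
have idN : ideal N.
  split.
  - by exists (fun=> 0) => //; rewrite big1 // => i _; rewrite mul0r.
  - move=> _ _ [c Ic ->] [d Id ->]; exists (fun i => c i + d i) => [i|]; first exact: ID.
    by rewrite -big_split; apply: eq_bigr => i _; rewrite mulrDl.
  - move=> a _ [c Ic ->]; exists (fun i => a * c i) => [i|]; first exact: IM.
    by rewrite mulr_sumr; apply: eq_bigr => i _; rewrite mulrA.
have NI b : N b -> I b by case=> c _ ->; exists c.
have nN1 : ~ N 1.
  by move=> /NI /muI; rewrite mu1 => /eqP; rewrite oner_eq0.
have [Q [g [gsurj gker]]] := quotient_ring idN nN1.
pose M : lmodType S := pullback (g \o rho \o q).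
pose D (s : S) : M := g (lam (q s) - rho (q s)) : Q.
have Dder : R_derivation f D.
  split.
  - move=> x y; rewrite /D; have := rmorphD g (lam (q x) - rho (q x)) (lam (q y) - rho (q y)).
    by move=> H; apply: etrans H; congr (g _); rewrite !rmorphD; ring.
  - move=> x y.
    (* This product of two elements of I is exactly the defect in the Leibniz rule. *)
    have /gker H : N ((lam (q x) - rho (q x)) * (lam (q y) - rho (q y))).
      have [c cE] := Idiff (q y); exists (fun i => (lam (q x) - rho (q x)) * c i).
        by move=> i; rewrite mulrC; exact: IM.
      by rewrite cE mulr_sumr; apply: eq_bigr => i _; rewrite mulrA.
    have : g (lam (q (x * y)) - rho (q (x * y))) =
       g (rho (q x)) * g (lam (q y) - rho (q y))
       + g (rho (q y)) * g (lam (q x) - rho (q x)).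
      apply/eqP; rewrite -subr_eq0 -!rmorphM -rmorphD -rmorphB -[X in _ == X]H.
      by apply/eqP; congr (g _); rewrite !rmorphM; ring.
    by [].
  - by move=> r; rewrite /D [lam _]lamrho subrr; exact: rmorph0.
have Nz i : N (z i) by apply/gker; exact: (der M D Dder (v i)).
have [H HP] : {H : 'I_n -> 'I_n -> B &
    forall i, (forall j, I (H i j)) /\ z i = \sum_j H i j * z j}.
  apply: (@choice _ _ (fun i c => (forall j, I (c j)) /\ z i = \sum_j c j * z j)) => i.
  by have [c] := Nz i; exists c.
(* Since z = H z with the entries of [H] in I, the matrix 1 - H kills z and has determinant 1 modulo
   I. *)
pose X : 'M[B]_n := 1%:M - \matrix_(i, j) H i j.
have ez k : \det X * z k = 0.
  apply: (@det_kills _ _ idfun (fun x => x = 0) n X z) => //.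
  - by move=> x y -> ->; rewrite addr0.
  - by move=> r x ->; rewrite mulr0.
  - move=> i /=; under eq_bigr do rewrite !mxE mulrBl.
    rewrite sumrB -(HP i).2 (bigD1 i) //= eqxx mul1r big1 ?addr0 ?subrr //.
    by move=> j; rewrite eq_sym => /negbTE ->; rewrite mul0r.
have muX : mu (\det X) = 1.
  have /muI : I (\det X - 1).
    rewrite -(det1 B n); apply: det_congr => // i j; rewrite !mxE addrAC subrr sub0r.
    by apply: ideal_opp => //; have [] := HP i.
  move=> E; have := muD (\det X - 1) 1; rewrite subrK E mu1 add0r //.
have [s sE] := Bgen (\det X); exists s; split; first by rewrite -muE -sE.
move=> a; rewrite -sE mulrC; have [c ->] := Idiff a.
by rewrite mulr_sumr big1 // => i _; rewrite mulrCA ez mulr0.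
Qed.

End Separability.

(** * Separable algebras over a field *)

Lemma tspan_ind (A : comNzRingType) (T V : A -> Prop) (K : eqType) (g : K -> A)
    (s : seq K) a :
  submodule T V -> (forall k, k \in s -> V (g k)) -> tspan T g s a -> V a.
Proof.
move=> [V0 VD VM]; elim: s a => [|k s IH] a Vs /=; first by move=> ->.
move=> [t Tt /IH Va]; rewrite -(subrK (t * g k) a); apply: VD.
  by apply: Va => j js; apply: Vs; rewrite inE js orbT.
by apply: VM => //; apply: Vs; rewrite inE eqxx.
Qed.

Lemma tspan_map (A : comNzRingType) (T : A -> Prop) (K : Type) (g : K -> A)
    (s : seq K) a :
  tspan T g s a -> tspan T id (map g s) a.
Proof. by elim: s a => //= k s IH a [t Tt /IH]; exists t. Qed.

Lemma finite_ext_tspan (R A : comNzRingType) (h : {rmorphism R -> A}) (bs : seq A) :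
  (forall a, tspan (inR h) id bs a) -> finite_ext h.
Proof.
move=> span; exists (size bs), (fun i => bs`_i) => a.
suff [c cE] : exists c : nat -> R, a = \sum_(i < size bs) h (c i) * bs`_i.
  by exists (fun i => c i).
elim: bs a {span}(span a) => [|b bs IH] a /=.
  by move=> ->; exists (fun=> 0); rewrite big_ord0.
move=> [_ [r <-] /IH [c cE]]; exists (fun i => if i is j.+1 then c j else r).
by rewrite big_ord_recl /= -cE addrC subrK.
Qed.

(** A form of FIP that is easy to combine over components, by taking products of code sets. One
    inclusion suffices, by symmetry in [T] and [T']. *)
Definition encoded (R A : comNzRingType) (h : {rmorphism R -> A}) : Prop :=
  exists (Y : finType) (Q : (A -> Prop) -> Y -> Prop),
    (forall T, subalgebra h T -> exists y, Q T y) /\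
    (forall T T' y, Q T y -> Q T' y -> forall x, T x -> T' x).

Section FieldBase.
Variables (R A : comNzRingType) (h : {rmorphism R -> A}).
Hypothesis hfield : forall r, h r <> 0 -> exists r', h r * h r' = 1.
Variables (B : comNzRingType) (lam rho : {rmorphism A -> B}).
Hypothesis Bgen :
  forall b, exists s : seq (A * A), b = \sum_(k <- s) lam k.1 * rho k.2.
Hypothesis Bker : forall s : seq (A * A), \sum_(k <- s) lam k.1 * rho k.2 = 0 <->
  forall phi, hlinear h phi -> \sum_(k <- s) phi k.1 * k.2 = 0.
Variable s0 : seq (A * A).
Hypothesis s0_one : \sum_(k <- s0) k.1 * k.2 = 1.
Hypothesis s0_comm :
  forall a, (lam a - rho a) * (\sum_(k <- s0) lam k.1 * rho k.2) = 0.

Local Notation F := (inR h).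
Let sF : subring F := subring_inR h.

Lemma subfield_inR : subfield F 1.
Proof.
split; [by exists 1; rewrite rmorph1 | exact: mulr1 | exact/eqP/oner_neq0 |].
move=> _ [r <-]; rewrite mul1r => /hfield[r' rr']; exists (h r') => //.
by exists r'.
Qed.

Lemma submodule_eq0 (T : A -> Prop) : submodule T (fun x => x = 0).
Proof. by split=> // [x y -> ->|t x _ ->]; rewrite ?addr0 ?mulr0. Qed.

Lemma hlinear_tlinear T W phi :
  (forall r, T (h r)) -> tlinear T W phi -> hlinear h phi.
Proof. by move=> TF [pD pM _]; split=> // _ x [r <-]; exact: pM. Qed.

Lemma hlinear_FF phi : tlinear F F phi -> hlinear h phi.
Proof. by apply: hlinear_tlinear => r; exists r. Qed.

(** A list representing (a (x) 1 - 1 (x) a) s. *)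
Let comm_list a (s : seq (A * A)) : seq (A * A) :=
  [seq (a * k.1, k.2) | k <- s] ++ [seq (k.1, - (a * k.2)) | k <- s].

Let comm_listE a s psi : \sum_(k <- comm_list a s) psi k.1 * k.2 =
  \sum_(k <- s) psi (a * k.1) * k.2 - a * \sum_(k <- s) psi k.1 * k.2.
Proof.
rewrite big_cat !big_map /= mulr_sumr -sumrN; congr (_ + _).
by apply: eq_bigr => k _; ring.
Qed.

Lemma tensor_commE (s : seq (A * A)) a :
  (lam a - rho a) * (\sum_(k <- s) lam k.1 * rho k.2) = 0 <->
  forall phi, hlinear h phi ->
    \sum_(k <- s) phi (a * k.1) * k.2 = a * \sum_(k <- s) phi k.1 * k.2.
Proof.
have -> : (lam a - rho a) * (\sum_(k <- s) lam k.1 * rho k.2)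
    = \sum_(k <- comm_list a s) lam k.1 * rho k.2.
  rewrite big_cat !big_map /= mulr_sumr -big_split /=; apply: eq_bigr => k _.
  by rewrite rmorphN !rmorphM; ring.
split=> [/Bker H phi lphi|H].
  by apply/eqP; rewrite -subr_eq0 -comm_listE; apply/eqP; exact: H.
by apply/Bker => phi lphi; rewrite comm_listE H // subrr.
Qed.

Lemma tensor_vanishing_F V (W : zmodType) (b : A -> A -> W) (Z : W -> Prop)
    (s : seq (A * A)) :
  submodule F V ->
  (forall x y z, b (x + y) z = b x z + b y z) ->
  (forall x y z, b x (y + z) = b x y + b x z) ->
  (forall t x y, F t -> b (t * x) y = b x (t * y)) ->
  Z 0 -> (forall x y, Z x -> Z y -> Z (x + y)) ->
  (forall phi, tlinear F F phi -> V (\sum_(k <- s) phi k.1 * k.2)) ->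
  (forall x v, x \in map fst s -> V v -> Z (b x v)) ->
  Z (\sum_(k <- s) b k.1 k.2).
Proof.
move=> sV bDl bDr bF Z0 ZD HV HZ.
have -> : \sum_(k <- s) b k.1 k.2 = \sum_(k <- s) b k.1 (1 * k.2).
  by apply: eq_bigr => k _; rewrite mul1r.
apply: (@tensor_vanishing A F 1 sF subfield_inR V W b Z sV) => // [phi lphi|x v xs Vv].
  by under eq_bigr do rewrite mul1r; exact: HV.
by rewrite mul1r; exact: HZ.
Qed.

(** Once the left factors are made independent over the field [F], the [F]-valued functionals force
    all right factors to vanish. *)
Lemma functional_detect (s : seq (A * A)) :
  (forall chi, tlinear F F chi -> \sum_(k <- s) chi k.1 * k.2 = 0) ->
  forall phi, hlinear h phi -> \sum_(k <- s) phi k.1 * k.2 = 0.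
Proof.
move=> Hs phi [pD pM _].
apply: (@tensor_vanishing_F _ A (fun x y => phi x * y) (fun x => x = 0) s
  (submodule_eq0 F)) => //.
- by move=> x y z; rewrite pD mulrDl.
- by move=> x y z; rewrite mulrDr.
- by move=> t x y Ft; rewrite pM // mulrCA mulrA.
- by move=> x y -> ->; rewrite addr0.
- by move=> x v _ ->; rewrite mulr0.
Qed.

Lemma tensor_comm_FF (s : seq (A * A)) a :
  (forall chi, tlinear F F chi ->
    \sum_(k <- s) chi (a * k.1) * k.2 = a * \sum_(k <- s) chi k.1 * k.2) ->
  (lam a - rho a) * (\sum_(k <- s) lam k.1 * rho k.2) = 0.
Proof.
move=> Hs; apply/tensor_commE => phi lphi; apply/eqP; rewrite -subr_eq0; apply/eqP.
rewrite -comm_listE; apply: functional_detect lphi => chi lchi.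
by rewrite comm_listE Hs // subrr.
Qed.

(** Write a = sum a x y over the separability element. With independent left factors, each right
    factor is v = sum phi(x) y, and c v = sum phi(c x) y lies in the span [Z] for every [c]. *)
Lemma separable_span a : tspan F (fun k => k.2) s0 a.
Proof.
set Z := tspan F (fun k => k.2) s0.
have sZ : submodule F Z by exact: submodule_tspan.
have [Z0 ZD ZM] := sZ.
pose V y := forall c, Z (c * y).
have sV : submodule F V.
  split=> [c|x y Vx Vy c|t x Ft Vx c]; first by rewrite mulr0.
    by rewrite mulrDr; exact: ZD.
  by rewrite mulrCA; exact: ZM.
have -> : a = \sum_(k <- s0) a * k.1 * k.2.
  by under eq_bigr do rewrite -mulrA; rewrite -mulr_sumr s0_one mulr1.
apply: (@tensor_vanishing_F V A (fun x y => a * x * y) Z s0 sV) => //.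
- by move=> x y z; ring.
- by move=> x y z; ring.
- by move=> t x y _; ring.
- move=> phi lphi c; have /tensor_commE <- := s0_comm c; last exact: hlinear_FF.
  apply: (submodule_sum sZ) => k ks; apply: (ZM); first by case: lphi.
  by apply: (mem_tspan (fun k : A * A => k.2)).
Qed.

(** If c^2 = 0, write c = sum (c x) y. After making the left factors independent, [c] kills the
    right factors, as c sum phi(c x) y = c^2 sum phi(x) y, while the left factors remain multiples
    of [c]. *)
Lemma separable_reduced (a : A) n : a ^+ n = 0 -> a = 0.
Proof.
have red1 (c : A) : c * c = 0 -> c = 0.
  move=> cc.
  have sV : submodule F (fun y => c * y = 0).
    split=> [|x y cx cy|t x _ cx]; first by rewrite mulr0.
      by rewrite mulrDr cx cy addr0.
    by rewrite mulrCA cx mulr0.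
  have -> : c = \sum_(k <- [seq (c * k.1, k.2) | k <- s0]) k.1 * k.2.
    rewrite big_map /=; under eq_bigr do rewrite -mulrA.
    by rewrite -mulr_sumr s0_one mulr1.
  apply: (@tensor_vanishing_F _ A (fun x y => x * y) (fun x => x = 0) _ sV) => //.
  - by move=> x y z; rewrite mulrDl.
  - by move=> x y z; rewrite mulrDr.
  - by move=> t x y _; ring.
  - by move=> x y -> ->; rewrite addr0.
  - move=> phi lphi; rewrite big_map /=.
    have /tensor_commE -> := s0_comm c; last exact: hlinear_FF.
    by rewrite mulrA cc mul0r.
  - move=> x v /mapP[k /mapP[j _ ->] ->] /= cv.
    by rewrite mulrAC cv mul0r.
elim: n => [|[|n] IH]; first by rewrite expr0 => /eqP; rewrite oner_eq0.
  by rewrite expr1.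
move=> an; apply: IH; apply: red1; rewrite -exprD addSn -addnS exprD.
by rewrite mulrC an mul0r.
Qed.

(** * Idempotents attached to subalgebras *)

Section Subalgebra.
Variable T : A -> Prop.
Hypothesis aT : subalgebra h T.

Let sT : subring T. Proof. by case: aT. Qed.
Let TF r : T (h r). Proof. by case: aT. Qed.

Lemma submodule_FT V : submodule T V -> submodule F V.
Proof. by case=> V0 VD VM; split=> // _ x [r <-]; exact: VM. Qed.

Lemma subalgebra_dcc : dcc T.
Proof.
move=> H sH HT Hdesc.
have sHF n : submodule F (H n) by exact: submodule_FT.
have span n x : H n x -> tspan F id (map snd s0) x.
  by move=> _; apply: tspan_map; exact: separable_span.
have [N NP] := submodule_dcc sF subfield_inR sHF Hdesc span.
by exists N => x; exact: NP.
Qed.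

(** The separability element is pushed into T (x) T by [T]-linear maps: [phi] on the left factors
    and y -> psi(e y) on the right ones. *)
Lemma separability_component e : subfield T e ->
  exists s : seq (A * A), [/\ forall k, k \in s -> T k.1 /\ T k.2,
    \sum_(k <- s) k.1 * k.2 = e
    & forall t, T t -> (lam t - rho t) * (\sum_(k <- s) lam k.1 * rho k.2) = 0].
Proof.
move=> fe; have [Te ee e0 _] := fe.
(* If all these sums vanished, [tensor_vanishing] would give e = 0. Next, [psi] is chosen with
   psi(z) = e, which makes the product of the new element equal to [e]. *)
have [phi [lphi zn0]] : exists phi, tlinear T T phi /\
    \sum_(k <- s0) phi k.1 * (e * k.2) <> 0.
  apply: contrapT => nphi; apply: e0.
  have -> : e = \sum_(k <- s0) k.1 * (e * k.2).
    by under eq_bigr do rewrite mulrCA; rewrite -mulr_sumr s0_one mulr1.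
  apply: (@tensor_vanishing A T e sT fe _ A (fun x y => x * y)
    (fun x => x = 0) (submodule_eq0 T)) => //.
  - by move=> x y z; rewrite mulrDl.
  - by move=> x y z; rewrite mulrDr.
  - by move=> t x y _; ring.
  - by move=> x y -> ->; rewrite addr0.
  - move=> phi lphi; apply: contrapT => nz; apply: nphi; by exists phi.
  - by move=> x v _ ->; rewrite !mulr0.
set z := (X in X <> 0) in zn0.
have ez : e * z = z.
  by rewrite mulr_sumr; apply: eq_bigr => k _; rewrite -[in RHS]ee; ring.
have [|psi [lpsi _ psiz]] := @separating_functional A T _ e z sT fe (submodule_eq0 T).
  by rewrite ez.
have [pD pM pT] := lphi; have [qD qM qT] := lpsi.
exists [seq (phi k.1, psi (e * k.2)) | k <- s0]; split.
- by move=> k /mapP[j _ ->] /=.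
- rewrite big_map /= -[RHS]psiz (tlinear_sum _ _ lpsi); apply: eq_bigr => k _.
  by rewrite [RHS]qM.
- move=> t Tt; apply: tensor_comm_FF => chi lchi; have [cD cM cT] := lchi.
  have lcp : hlinear h (fun x => chi (phi x)).
    split=> // [x y|_ x [r <-]]; first by rewrite pD cD.
    by rewrite pM // cM //; exists r.
  have TcT x : T (chi x) by have [r <-] := cT x.
  rewrite !big_map /=.
  (* The values of [chi] lie in [F], hence in [T], so they pass through [psi]; this transports the
     commutation relation of [s0]. *)
  transitivity (psi (e * \sum_(k <- s0) chi (phi (t * k.1)) * k.2)).
    rewrite mulr_sumr (tlinear_sum _ _ lpsi); apply: eq_bigr => k _.
    by rewrite [in RHS]mulrCA [RHS]qM // pM.
  have /tensor_commE/(_ _ lcp) -> := s0_comm t.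
  rewrite mulrCA [LHS]qM //; congr (_ * _).
  rewrite mulr_sumr (tlinear_sum _ _ lpsi); apply: eq_bigr => k _.
  by rewrite mulrCA [LHS]qM.
Qed.

(** The components over primitive idempotents of [T] add up to a separability element [b] of [T]. It
    is idempotent because multiplication by [b] identifies left and right factors from [T]. *)
Lemma subalgebra_idempotent :
  exists2 b : B, b * b = b & forall a, T a <-> (lam a - rho a) * b = 0.
Proof.
have [T1 TB TM] := sT.
have [l l1 lP] := idempotent_decomposition sT subalgebra_dcc.
have reg t : T t -> exists2 u, T u & t = t * t * u.
  apply: dcc_regular => //; first exact: subalgebra_dcc.
  by move=> x n _; exact: separable_reduced.
have [s [sT' s1 sC]] : exists s : seq (A * A),
    [/\ forall k, k \in s -> T k.1 /\ T k.2, \sum_(k <- s) k.1 * k.2 = 1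
    & forall t, T t -> (lam t - rho t) * (\sum_(k <- s) lam k.1 * rho k.2) = 0].
  rewrite -l1; elim: l {l1} lP => [_|e l IH lP].
    exists nil; split=> //; first by rewrite !big_nil.
    by move=> t _; rewrite big_nil mulr0.
  have [|s [sT' s1 sC]] := IH; first by move=> c cl; apply: lP; rewrite inE cl orbT.
  have [|u [uT u1 uC]] := @separability_component e.
    by apply: primitive_subfield => //; apply: lP; rewrite inE eqxx.
  exists (u ++ s); split.
  - by move=> k; rewrite mem_cat => /orP[/uT|/sT'].
  - by rewrite big_cat big_cons /= u1 s1.
  - by move=> t Tt; rewrite big_cat /= mulrDr uC // sC // addr0.
set b := \sum_(k <- s) lam k.1 * rho k.2 in sC.
have sw t : T t -> b * lam t = b * rho t.
  move=> /sC H; apply/eqP; rewrite -subr_eq0 -mulrBr mulrC H //.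
exists b.
  rewrite {2}/b mulr_sumr -[RHS]mulr1 -(rmorph1 rho) -s1 rmorph_sum mulr_sumr.
  rewrite big_seq [RHS]big_seq; apply: eq_bigr => k /sT'[Tk _].
  by rewrite mulrA sw // rmorphM mulrA.
move=> a; split=> [/sC //|/tensor_commE aC].
(* Conversely, if [a] commutes with [b], then a sum phi(x) y = sum phi(a x) y is in [T]; with
   independent left factors this puts a = sum a x y in [T]. *)
pose V y := T (a * y).
have sV : submodule F V.
  split; rewrite /V.
  - by rewrite mulr0; exact: subring0.
  - by move=> x y Vx Vy; rewrite mulrDr; exact: subringD.
  - by move=> _ x [r <-] Vx; rewrite mulrCA; exact: TM.
have -> : a = \sum_(k <- s) a * k.1 * k.2.
  by under eq_bigr do rewrite -mulrA; rewrite -mulr_sumr s1 mulr1.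
apply: (@tensor_vanishing_F V A (fun x y => a * x * y) T s sV) => //.
- by move=> x y z; ring.
- by move=> x y z; ring.
- by move=> t x y _; ring.
- exact: subring0.
- by move=> x y; exact: subringD.
- move=> phi lphi; rewrite /V -aC; last exact: hlinear_FF.
  rewrite big_seq; elim/big_ind: _ => [||k /sT'[_ Tk]]; first exact: subring0.
    by move=> x y; exact: subringD.
  by apply: (TM) => //; have [_ _ /(_ (a * k.1)) [r <-]] := lphi.
- move=> x v /mapP[k /sT'[Tk _] ->] Vv; rewrite -mulrA mulrCA.
  exact: TM.
Qed.

End Subalgebra.

(** Products of the right factors of [s0], placed on both sides, span [B] over the image of [R]. *)
Lemma tensor_dcc : dcc (fun _ : B => True).
Proof.
have bal := tensor_balanced Bker.
pose g : {rmorphism R -> B} := lam \o h.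
pose bs := [seq lam k.2 * rho j.2 | k <- s0, j <- s0].
have sG : subring (inR g) := subring_inR g.
have fG : subfield (inR g) 1.
  split; [by exists 1; rewrite rmorph1 | exact: mulr1 | exact/eqP/oner_neq0 |].
  move=> _ [r <-]; rewrite mul1r => gr; have [|r' rr'] := hfield (r := r).
    by move=> hr; apply: gr; rewrite /= hr rmorph0.
  by exists (g r'); [exists r' | rewrite /= -rmorphM rr' rmorph1].
have sS := submodule_tspan id bs sG; have [S0 SD SM] := sS.
have span b : tspan (inR g) id bs b.
  have [s ->] := Bgen b; apply: (submodule_sum sS) => -[x y] _ /=.
  have Hx := separable_span x; have Hy := separable_span y.
  apply: (@tspan_ind A F (fun x => tspan (inR g) id bs (lam x * rho y)) _
    (fun k => k.2) s0 x) Hx.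
    split=> [|u v|_ u [r <-]]; first by rewrite rmorph0 mul0r.
      by rewrite rmorphD mulrDl; exact: SD.
    by rewrite rmorphM -mulrA; apply: SM; exists r.
  move=> k ks; apply: (@tspan_ind A F (fun y => tspan (inR g) id bs (lam k.2 * rho y)) _
    (fun k => k.2) s0 y) Hy.
    split=> [|u v|_ u [r <-]]; first by rewrite rmorph0 mulr0.
      by rewrite rmorphD mulrDr; exact: SD.
    by rewrite rmorphM -bal mulrCA; apply: SM; exists r.
  by move=> j js; apply: mem_tspan => //; apply: allpairs_f.
move=> H sH _ Hdesc.
have sHG n : submodule (inR g) (H n).
  by have [H0 HD HM] := sH n; split=> // t x _; exact: HM.
have [N NP] := submodule_dcc sG fG sHG Hdesc (fun n x _ => span x).
by exists N => x; exact: NP.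
Qed.

Lemma separable_encoded : encoded h.
Proof.
have sB : subring (fun _ : B => True) by [].
have [l l1 lP] := idempotent_decomposition sB tensor_dcc.
(* An idempotent is the sum of the primitive idempotents of [l] that it fixes, since it annihilates
   the others. *)
pose code (b : B) : {ffun 'I_(size l) -> bool} := [ffun i : 'I_(size l) => b * l`_i == l`_i].
have codeE b : b * b = b -> b = \sum_(i < size l) if code b i then l`_i else 0.
  move=> bb; rewrite -{1}[b]mulr1 -l1 (big_nth 0) big_mkord mulr_sumr.
  apply: eq_bigr => i _; rewrite ffunE.
  have [_ _ l0 prim] := lP _ (mem_nth 0 (ltn_ord i)).
  have [->|->] := prim b I bb; last by rewrite eqxx.
  by case: eqP => // /esym.
exists {ffun 'I_(size l) -> bool}, (fun T y => exists b,
  [/\ b * b = b, code b = y & forall a, T a <-> (lam a - rho a) * b = 0]).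
split=> [T aT|T T' y [b [bb by_ bT]] [b' [bb' by' bT']] x].
  by have [b bb bT] := subalgebra_idempotent aT; exists (code b), b.
have -> : T x <-> T' x by rewrite bT bT' (codeE b) // (codeE b') // by_ by'.
by [].
Qed.

End FieldBase.

(** * From FIP to the nucleus *)

Section Nucleus.
Variables (R S : comNzRingType) (f : {rmorphism R -> S}).

Lemma ideal_conductor : ideal (conductor f).
Proof.
have [R1 RB RM] := subring_inR f; split.
- by move=> s; rewrite rmorph0 mul0r; exact: subring0 (subring_inR f).
- by move=> x y Cx Cy s; rewrite rmorphD mulrDl; apply: subringD => //; exact: subring_inR.
- by move=> a x Cx s; rewrite rmorphM -mulrA; apply: RM => //; exists a.
Qed.

(** If r^2 is in the conductor, then (r s)^2 and (r s)^3 are in [R] for every [s], hence so is r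
    s. *)
Lemma seminormal_nucleus_reduced : seminormal f -> nucleus_reduced f.
Proof.
have [_ _ CM] := ideal_conductor.
move=> sn; have red2 r : conductor f (r * r) -> conductor f r.
  move=> Cr s; apply: sn.
    by have := Cr (s ^+ 2); congr inR; rewrite rmorphM; ring.
  by have := Cr (f r * s ^+ 3); congr inR; rewrite rmorphM; ring.
move=> r; elim=> [|[|k] IH]; first by rewrite expr0 => C1; rewrite -[r]mulr1; exact: CM.
  by rewrite expr1.
move=> Ck; apply: IH; apply: red2; rewrite -exprD addSn -addnS exprD.
exact: CM.
Qed.

(** By the pigeonhole principle one subalgebra recurs arbitrarily late, so the chain is constant
    from its first chosen occurrence on. *)
Lemma FIP_chain (T : nat -> S -> Prop) :
  FIP f -> (forall n, subalgebra f (T n)) -> (forall n x, T n.+1 x -> T n x) ->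
  exists N, forall n, (N <= n)%N -> forall x, T N x -> T n x.
Proof.
move=> [k [F FP]] aT Tdesc.
have Tle := descending_le Tdesc.
have [idx idxP] := choice (fun n => FP _ (aT n)).
have [i iP] : exists i, forall M, exists2 n, (M <= n)%N & idx n = i.
  apply: contrapT => ni.
  have [M MP] : {M : 'I_k -> nat & forall i n, (M i <= n)%N -> idx n <> i}.
    apply: (@choice _ _ (fun i M => forall n, (M <= n)%N -> idx n <> i)) => i.
    apply: contrapT => nM; apply: ni; exists i => M; apply: contrapT => nn.
    by apply: nM; exists M => n leM E; apply: nn; exists n.
  by apply: (MP (idx (\max_i M i)) (\max_i M i)) => //; exact: leq_bigmax.
have [N _ iN] := iP 0%N; exists N => n leNn x TNx.
have [m lenm im] := iP n; apply: (Tle n m) => //.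
by apply/idxP; rewrite im -iN; apply/idxP.
Qed.

Hypotheses (fip : FIP f) (fin : finite_ext f) (red : nucleus_reduced f).

Lemma conductor_gen n (g : 'I_n -> S) r :
  (forall s, exists c : 'I_n -> R, s = \sum_i f (c i) * g i) ->
  (forall i, inR f (f r * g i)) -> conductor f r.
Proof.
have [R1 RB RM] := subring_inR f; move=> ggen Rg s; have [c ->] := ggen s.
rewrite mulr_sumr; apply: subring_sum => [|i]; first exact: subring_inR.
by rewrite mulrCA; apply: RM => //; exists (c i).
Qed.

(* Nakayama's lemma for [S/R]: the chain [R + r^k S] is stationary. *)
Lemma nucleus_regular r : exists u, conductor f (r - r * r * u).
Proof.
have [n [g ggen]] := fin; have [R1 RB RM] := subring_inR f.
pose T k s := exists r0 s', s = f r0 + f (r ^+ k) * s'.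
have [||N NP] := @FIP_chain T fip.
- move=> k; split.
  + by move=> r0; exists r0, 0; rewrite mulr0 addr0.
  + move=> _ _ [a [s ->]] [b [t ->]]; exists (a - b), (s - t).
    by rewrite rmorphB; ring.
  + move=> _ _ [a [s ->]] [b [t ->]].
    exists (a * b), (f a * t + f b * s + f (r ^+ k) * s * t).
    by rewrite rmorphM; ring.
  + by exists 1, 0; rewrite mulr0 addr0 rmorph1.
- by move=> k _ [a [s ->]]; exists a, (f r * s); rewrite exprSr rmorphM mulrA.
have /choice[r0 r0P] : forall i, exists r0, exists s',
    f (r ^+ N) * g i = f r0 + f (r ^+ N.+1) * s'.
  by move=> i; apply: (NP N.+1 (leqnSn N)); exists 0, (g i); rewrite rmorph0 add0r.
have [s' s'P] := choice r0P.
have [c cP] := choice (fun i => ggen (s' i)).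
(* [M] sends the vector r^N g into [R], so det M r^N is in the conductor; moreover det M is 1 modulo
   [r]. *)
pose M : 'M[R]_n := 1%:M - r *: \matrix_(i, j) c i j.
have idr : ideal (fun x => exists u, x = r * u).
  split; first by exists 0; rewrite mulr0.
    by move=> _ _ [u ->] [v ->]; exists (u + v); rewrite mulrDr.
  by move=> a _ [u ->]; exists (a * u); rewrite mulrCA.
have [u uE] : exists u, \det M - 1 = r * u.
  rewrite -(det1 R n); apply: (det_congr idr) => i j.
  by exists (- c i j); rewrite !mxE addrAC subrr sub0r mulrN.
have CM : conductor f (\det M * r ^+ N).
  apply: (conductor_gen ggen) => k; rewrite rmorphM -mulrA.
  apply: (@det_kills _ _ f (inR f) n M (fun j => f (r ^+ N) * g j)).
  - exact: subring0 (subring_inR f).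
  - by move=> x y; exact: subringD (subring_inR f).
  - by move=> a x; apply: RM; exists a.
  move=> i; exists (r0 i); apply/esym/eqP; rewrite -subr_eq0; apply/eqP.
  under eq_bigr do rewrite !mxE rmorphB mulrBl.
  rewrite sumrB (bigD1 i) //= eqxx rmorph1 mul1r big1 => [|j]; last first.
    by rewrite eq_sym => /negbTE ->; rewrite rmorph0 mul0r.
  rewrite addr0 s'P; set w := (X in _ - X - _).
  have -> : w = f (r ^+ N.+1) * s' i.
    rewrite /w cP mulr_sumr; apply: eq_bigr => j _.
    by rewrite exprSr !rmorphM; ring.
  by ring.
(* Here det M = 1 + r u, and the power N + 1 of r (1 + r u) contains the factor det M r^N. *)
exists (- u); apply: (red (k := N.+1)).
have -> : (r - r * r * - u) ^+ N.+1
    = r * (1 + r * u) ^+ N * ((1 + r * u) * r ^+ N).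
  have -> : r - r * r * - u = r * (1 + r * u) by ring.
  by rewrite exprMn !exprS; ring.
have -> : 1 + r * u = \det M by rewrite -uE addrC subrK.
by have [_ _ CMul] := ideal_conductor; exact: CMul.
Qed.

(* The same argument applied to [R + J S]: if [j S] lies in [R + J S], then some
   power of [j] lies in [J]. *)
Lemma FIP_nucleus_artinian : nucleus_artinian f.
Proof.
move=> J idJ CJ Jdesc; have [n [g ggen]] := fin; have [R1 RB RM] := subring_inR f.
have Jle := descending_le Jdesc.
pose JS k s := exists2 c : 'I_n -> R, forall i, J k (c i) & s = \sum_i f (c i) * g i.
have JSD k x y : JS k x -> JS k y -> JS k (x + y).
  move=> [c Jc ->] [d Jd ->]; have [_ JD _] := idJ k.
  exists (fun i => c i + d i) => [i|]; first exact: JD.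
  by rewrite -big_split; apply: eq_bigr => i _; rewrite rmorphD mulrDl.
have JSM k x s : JS k x -> JS k (x * s).
  move=> [c Jc ->]; have [_ _ JM] := idJ k.
  have [d dP] := choice (fun i => ggen (g i * s)).
  exists (fun j => \sum_i c i * d i j) => [j|].
    by apply: ideal_sum => // i; rewrite mulrC; exact: JM.
  rewrite mulr_suml; under eq_bigr do rewrite -mulrA dP mulr_sumr.
  rewrite exchange_big; apply: eq_bigr => j _; rewrite rmorph_sum mulr_suml.
  by apply: eq_bigr => i _; rewrite rmorphM mulrA.
have JSN k x : JS k x -> JS k (- x) by move=> Jx; rewrite -mulrN1; exact: JSM.
have JS0 k : JS k 0.
  exists (fun=> 0) => [_|]; first by case: (idJ k).
  by rewrite big1 // => i _; rewrite rmorph0 mul0r.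
pose T k s := exists r0 x, JS k x /\ s = f r0 + x.
have [||N NP] := @FIP_chain T fip.
- move=> k; split.
  + by move=> r0; exists r0, 0; rewrite addr0.
  + move=> _ _ [a [s [Js ->]]] [b [t [Jt ->]]]; exists (a - b), (s - t).
    by split; [exact: JSD (JSN _ _ _) | rewrite rmorphB; ring].
  + move=> _ _ [a [s [Js ->]]] [b [t [Jt ->]]].
    exists (a * b), (t * f a + s * (f b + t)).
    by split; [apply: JSD; exact: JSM | rewrite rmorphM; ring].
  + by exists 1, 0; rewrite rmorph1 addr0.
- move=> k _ [a [s [[c Jc ->] ->]]]; exists a, (\sum_i f (c i) * g i); split=> //.
  by exists c => // i; exact: Jdesc.
exists N => k leNk j; split; first exact: Jle.
move=> Jj; have idJk := idJ k; have [J0 JD JM] := idJk.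
have /choice[r0 r0P] : forall i, exists r0, exists2 c : 'I_n -> R,
    forall l, J k (c l) & f j * g i = f r0 + \sum_l f (c l) * g l.
  move=> i; have [|r0 [x [[c Jc ->] E]]] := NP k leNk (f j * g i); last by exists r0, c.
  exists 0, (f j * g i); split; last by rewrite rmorph0 add0r.
  exists (fun l => (l == i)%:R * j) => [l|]; first by have [_ _ JNM] := idJ N; exact: JNM.
  rewrite (bigD1 i) //= eqxx mul1r big1 ?addr0 // => l /negbTE ->.
  by rewrite mul0r rmorph0 mul0r.
have [c cP] : {c : 'I_n -> 'I_n -> R & forall i, (forall l, J k (c i l)) /\
    f j * g i = f (r0 i) + \sum_l f (c i l) * g l}.
  apply: (@choice _ _ (fun i c => (forall l, J k (c l)) /\
    f j * g i = f (r0 i) + \sum_l f (c l) * g l)) => i.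
  by have [c] := r0P i; exists c.
(* [M] sends [g] into [R], so det M is in the conductor and hence in [J k]; it is also j^n modulo
   [J k]. *)
pose M : 'M[R]_n := j%:M - \matrix_(i, l) c i l.
have CM : conductor f (\det M).
  apply: (conductor_gen ggen) => l; apply: det_kills.
  - exact: subring0 (subring_inR f).
  - by move=> x y; exact: subringD (subring_inR f).
  - by move=> a x; apply: RM; exists a.
  move=> i; exists (r0 i); apply/esym/eqP; rewrite -subr_eq0; apply/eqP.
  under eq_bigr do rewrite !mxE rmorphB mulrBl.
  rewrite sumrB (bigD1 i) //= eqxx mulr1n big1 => [|m]; last first.
    by rewrite eq_sym => /negbTE ->; rewrite mulr0n rmorph0 mul0r.
  by rewrite addr0 (cP i).2; ring.
have Jjn : J k (j ^+ n).
  have JdM : J k (\det M - j ^+ n).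
    rewrite -(det_scalar n j); apply: det_congr => // i l; rewrite !mxE addrAC subrr sub0r.
    by apply: ideal_opp => //; have [] := cP i.
  have := JD _ _ (CJ k _ CM) (ideal_opp idJk JdM); congr (J k); ring.
(* As j - j^2 u lies in [J k], the exponent of [j] can be lowered step by step to 1. *)
have [u Cu] := nucleus_regular j.
elim: n Jjn {g ggen JS JSD JSM JSN JS0 T NP r0 r0P c cP M CM} => [|[|m] IH].
- by rewrite expr0 => J1; rewrite -[j]mulr1; exact: JM.
- by rewrite expr1.
move=> Jm; apply: IH.
have := JD _ _ (JM (j ^+ m) _ (CJ k _ Cu)) (JM u _ Jm).
by congr (J k); rewrite !exprS; ring.
Qed.

End Nucleus.

(** * From the nucleus to FIP *)

(** The set attached to a code is the union of all [T] carrying it; these coincide. *)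
Lemma FIP_encoded (R S : comNzRingType) (f : {rmorphism R -> S}) :
  encoded f -> FIP f.
Proof.
move=> [Y [Q [Qex Quniq]]].
exists #|Y|, (fun i x => exists2 T, Q T (enum_val i) & T x) => T /Qex[y Qy].
exists (enum_rank y) => x; rewrite enum_rankK; split=> [Tx|[T' QT' T'x]].
  by exists T.
exact: Quniq QT' Qy _ T'x.
Qed.

Section Gluing.
Variables (R S : comNzRingType) (f : {rmorphism R -> S}).
Hypothesis unr : unramified f.

Local Notation C := (conductor f).

Let sR : subring (inR f) := subring_inR f.

(** For [e] idempotent modulo [C], this is the kernel of the projection of [S] onto the
    [e]-component of S/C. *)
Definition component_ideal (e : R) (s : S) : Prop :=
  exists2 c, C c & f e * s = f c.

Lemma ideal_component e : ideal (component_ideal e).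
Proof.
have [C0 CD CM] := ideal_conductor f; split.
- by exists 0; rewrite ?mulr0 ?rmorph0.
- move=> x y [c Cc cE] [d Cd dE]; exists (c + d); first exact: CD.
  by rewrite mulrDr cE dE rmorphD.
- move=> a x [c Cc cE]; have [r rE] := Cc a; exists r.
    move=> s; rewrite rE -mulrA; exact: Cc.
  by rewrite rE mulrCA cE mulrC.
Qed.

(** The image of [R] in the component is a field, and the quotient inherits vanishing differentials
    from [S], so the theory of separable algebras applies. *)
Lemma component_quotient (e : R) :
  ~ C e -> (forall r, ~ C (e * r) -> exists r', C (e * r * r' - e)) ->
  exists (A : comNzRingType) (q : {rmorphism S -> A}),
    [/\ forall a, exists s, q s = a, forall s, q s = 0 <-> component_ideal e s,
        finite_ext (q \o f), encoded (q \o f) &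
        (forall (a : A) n, a ^+ n = 0 -> a = 0) /\
        (forall r, q (f r) <> 0 -> exists r', q (f r) * q (f r') = 1)].
Proof.
move=> nCe einv.
have nI1 : ~ component_ideal e 1.
  move=> [c Cc]; rewrite mulr1 => ec; apply: nCe => s.
  by rewrite ec; exact: Cc.
have [A [q [qsurj qker]]] := quotient_ring (ideal_component e) nI1.
have [C0 CD CM] := ideal_conductor f.
have qf0 r : C (e * r) -> q (f r) = 0.
  by move=> Cer; apply/qker; exists (e * r); rewrite ?rmorphM.
have hfield r : q (f r) <> 0 -> exists r', q (f r) * q (f r') = 1.
  move=> qr; have [|r' Cr'] := einv r; first by move=> /qf0.
  exists r'; apply/eqP; rewrite -subr_eq0 -!rmorphM -(rmorph1 q) -(rmorph1 f) -!rmorphB.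
  by apply/eqP/qf0; rewrite mulrBr mulr1 mulrA.
have [B [lam [rho [Bgen Bker]]]] := tensor_square (fin_type_quotient qsurj unr).
have [s [s1 sC]] := separability_element qsurj unr Bgen Bker.
exists A, q; split=> //.
- apply: (@finite_ext_tspan _ _ (q \o f) (map snd s)) => a.
  by apply: tspan_map; exact: (@separable_span _ _ (q \o f) hfield _ lam rho Bker s s1 sC).
- exact: (@separable_encoded _ _ (q \o f) hfield _ lam rho Bgen Bker s s1 sC).
- by split=> // a n; exact: (@separable_reduced _ _ (q \o f) hfield _ lam rho Bker s s1 sC).
Qed.

Section Decomposition.
Variable l : seq R.
Hypothesis l1 : C (1 - \sum_(e <- l) e).
Hypothesis lC : forall e, e \in l -> ~ C e.
Hypothesis linv :
  forall e, e \in l -> forall r, ~ C (e * r) -> exists r', C (e * r * r' - e).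

(** The remainder (1 - sum e) s is in [R], because 1 - sum e is in the conductor. *)
Let decompose s : exists r, s = \sum_(e <- l) f e * s + f r.
Proof.
have [r rE] := l1 s; exists r; rewrite rE rmorphB rmorph1 rmorph_sum -mulr_suml; ring.
Qed.

Lemma nucleus_finite : finite_ext f.
Proof.
have [G GP] : exists G : seq S, forall e, e \in l -> forall s, tspan (inR f) id G (f e * s).
  elim: l lC linv => [|e l' IH] lC' linv'; first by exists nil.
  have [||G GP] := IH.
  - by move=> c cl; apply: lC'; rewrite inE cl orbT.
  - by move=> c cl; apply: linv'; rewrite inE cl orbT.
  have el : e \in e :: l' by rewrite inE eqxx.
  have [A [q [qsurj qker [n [g ggen]] _ _]]] := component_quotient (lC' e el) (linv' e el).
  have [g' g'E] := choice (fun i => qsurj (g i)).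
  (* Lifted generators describe e S up to an error in [C], which the generator 1 absorbs. *)
  exists ((1 :: [seq g' i | i <- enum 'I_n]) ++ G) => c.
  set L := _ ++ G; have sL := submodule_tspan id L sR; have [L0 LD LM] := sL.
  rewrite inE => /orP[/eqP ->|cl] s; last first.
    apply: (@tspan_ind _ _ _ _ _ G _ sL _ (GP c cl s)) => k kG.
    by apply: mem_tspan => //; rewrite mem_cat kG orbT.
  have [d dE] := ggen (q s).
  have /qker[r Cr rE] : q (s - \sum_(i < n) f (d i) * g' i) = 0.
    rewrite rmorphB rmorph_sum dE; apply/eqP; rewrite subr_eq0; apply/eqP.
    by apply: eq_bigr => i _; rewrite rmorphM g'E.
  have -> : f e * s = f r * 1 + \sum_(i <- enum 'I_n) f (e * d i) * g' i.
    rewrite -rE mulrBr mulr1 mulr_sumr big_enum /=.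
    under [X in _ + X]eq_bigr do rewrite rmorphM -mulrA.
    by rewrite subrK.
  apply: (LD).
    by apply: (LM); [exists r | apply: mem_tspan => //; rewrite inE eqxx].
  apply: (submodule_sum sL) => i _; apply: (LM); first by exists (e * d i).
  apply: mem_tspan => //; rewrite mem_cat inE map_f ?orbT // mem_enum //.
apply: (@finite_ext_tspan _ _ f (1 :: G)) => s.
have [r ->] := decompose s.
have sL := submodule_tspan id (1 :: G) sR; have [L0 LD LM] := sL.
apply: (LD); last first.
  by rewrite -[f r]mulr1; apply: LM; [exists r | apply: mem_tspan => //; rewrite inE eqxx].
apply: (submodule_sum sL) => e el.
apply: (@tspan_ind _ _ _ _ _ G _ sL _ (GP e el s)) => k kG.
by apply: mem_tspan => //; rewrite inE kG orbT.
Qed.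

Lemma nucleus_seminormal : seminormal f.
Proof.
have [R1 RB RM] := sR; move=> b [r2 r2E] [r3 r3E]; have [r bE] := decompose b.
rewrite bE; apply: subringD => //; last by exists r.
rewrite big_seq; elim/big_ind: _ => [||e el]; first exact: subring0.
  by move=> x y; exact: subringD.
have [A [q [qsurj qker _ _ [Ared hfield]]]] := component_quotient (lC el) (linv el).
(* In each component b is 0 if b^2 is, by reducedness, and is b^3 / b^2 otherwise. *)
have [q0|/hfield[r' rr']] := EM (q (f r2) = 0).
  have /qker[c _ ->] : q b = 0.
    by apply: (Ared _ 2); rewrite -rmorphXn -r2E.
  by exists c.
have /qker[c _ cE] : q (b - f (r3 * r')) = 0.
  rewrite rmorphB !rmorphM r3E; apply/eqP; rewrite subr_eq0; apply/eqP.
  by rewrite -[LHS]mulr1 -rr' r2E !rmorphXn; ring.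
exists (c + e * (r3 * r')); rewrite rmorphD rmorphM -cE; ring.
Qed.

Lemma nucleus_FIP : FIP f.
Proof.
have [Y [Q [Qex Quniq]]] : exists (Y : finType) (Q : (S -> Prop) -> Y -> Prop),
    (forall T, subalgebra f T -> exists y, Q T y) /\
    (forall T T' y, subalgebra f T' -> Q T y -> Q T' y ->
       forall e, e \in l -> forall x, T x -> T' (f e * x)).
  elim: l lC linv => [|e l' IH] lC' linv'.
    by exists unit, (fun _ _ => True); split=> // T _; exists tt.
  have [||Y [Q [Qex Quniq]]] := IH.
  - by move=> c cl; apply: lC'; rewrite inE cl orbT.
  - by move=> c cl; apply: linv'; rewrite inE cl orbT.
  have el : e \in e :: l' by rewrite inE eqxx.
  have [A [q [qsurj qker _ [Y' [Q' [Qex' Quniq']]] _]]] :=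
    component_quotient (lC' e el) (linv' e el).
  (* The code of [T] collects codes of its images in the components; equal images differ, after
     multiplication by [e], by elements of [R] only. *)
  pose im (T : S -> Prop) a := exists2 x, T x & q x = a.
  exists (Y * Y')%type, (fun T y => Q T y.1 /\ Q' (im T) y.2); split.
    move=> T aT; have [y Qy] := Qex T aT.
    have [|y' Qy'] := Qex' (im T); last by exists (y, y').
    have [TR TB TM T1] := aT; split.
    - by move=> r; exists (f r).
    - by move=> _ _ [x Tx <-] [y' Ty <-]; exists (x - y'); [exact: TB | rewrite rmorphB].
    - by move=> _ _ [x Tx <-] [y' Ty <-]; exists (x * y'); [exact: TM | rewrite rmorphM].
    - by exists 1 => //; rewrite rmorph1.
  move=> T T' y aT' [Qy Qy'] [Q2 Q2'] c; rewrite inE => /orP[/eqP ->|cl] x Tx; last first.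
    exact: (Quniq _ _ _ aT' Qy Q2).
  have [|x' T'x' xx'] := Quniq' _ _ _ Qy' Q2' (q x); first by exists x.
  have /qker[r Cr rE] : q (x - x') = 0 by rewrite rmorphB xx' subrr.
  have [T'R T'B T'M T'1] := aT'.
  have -> : f e * x = f e * x' + f r by rewrite -rE; ring.
  by apply: subringD => //; apply: T'M.
(* [encoded] asks for uniqueness among all predicates, so being a subalgebra is made part of the
   relation. *)
apply: FIP_encoded; exists Y, (fun T y => subalgebra f T /\ Q T y); split.
  by move=> T aT; have [y Qy] := Qex T aT; exists y.
move=> T T' y [aT Qy] [aT' Qy'] x Tx; have [T'R T'B T'M T'1] := aT'.
have [r ->] := decompose x; apply: subringD => //.
rewrite big_seq; elim/big_ind: _ => [||e el]; first exact: subring0.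
  by move=> ? ?; exact: subringD.
exact: (Quniq _ _ _ aT' Qy Qy').
Qed.

End Decomposition.

(** R/C is von Neumann regular, so its primitive idempotents cut out fields; [l] lifts them to
    [R]. *)
Lemma artinian_reduced_decomposition :
  nucleus_artinian f -> nucleus_reduced f -> ~ C 1 ->
  exists l : seq R, [/\ C (1 - \sum_(e <- l) e), forall e, e \in l -> ~ C e
    & forall e, e \in l -> forall r, ~ C (e * r) -> exists r', C (e * r * r' - e)].
Proof.
move=> art red nC1.
have [X [p [psurj pker]]] := quotient_ring (ideal_conductor f) nC1.
have sX : subring (fun _ : X => True) by [].
have Xdcc : dcc (fun _ : X => True).
  move=> H sH _ Hdesc; have [|n r Cr|n r|N NP] := art (fun n r => H n (p r)).
  - move=> n; have [H0 HD HM] := sH n; split; rewrite ?rmorph0 //.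
      by move=> x y; rewrite rmorphD; exact: HD.
    by move=> a x; rewrite rmorphM; exact: HM.
  - by have [H0 _ _] := sH n; rewrite (pker r).2.
  - exact: Hdesc.
  by exists N => x; have [r <-] := psurj x => Hr; apply/(NP N.+1 (leqnSn N)).
have Xred (x : X) n : True -> x ^+ n = 0 -> x = 0.
  have [r <-] := psurj x => _; rewrite -rmorphXn => /pker Cr.
  by apply/pker; exact: red Cr.
have [l l1 lP] := idempotent_decomposition sX Xdcc.
have lf e : e \in l -> subfield (fun _ => True) e.
  move=> el; apply: primitive_subfield; [by []| |exact: lP].
  by move=> t _; exact: dcc_regular.
have [sec secP] := choice psurj.
exists (map sec l); split.
- apply/pker; rewrite rmorphB rmorph1 rmorph_sum big_map -l1.
  by apply/eqP; rewrite subr_eq0; apply/eqP/eq_bigr => e _; rewrite secP.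
- move=> _ /mapP[e /lf[_ _ e0 _] ->] /pker; rewrite secP //.
- move=> _ /mapP[e /lf[_ _ _ einv] ->] r nC.
  have [//||u _ uE] := einv (p r).
    by rewrite -(secP e) -rmorphM => /pker.
  have [r' r'E] := psurj u; exists r'; apply/pker.
  by rewrite rmorphB !rmorphM secP r'E uE subrr.
Qed.

Lemma artinian_reduced_nucleus :
  nucleus_artinian f -> nucleus_reduced f ->
  [/\ FIP f, seminormal f & finite_ext f].
Proof.
(* If 1 is in the conductor, then [R] maps onto [S] and the nucleus is zero; this case is treated
   directly. *)
move=> art red; have [C1|nC1] := EM (C 1); last first.
  have [l [l1 lC linv]] := artinian_reduced_decomposition art red nC1.
  split; [exact: (@nucleus_FIP l) | exact: (@nucleus_seminormal l)
    | exact: (@nucleus_finite l)].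
have all_inR s : inR f s by have := C1 s; rewrite rmorph1 mul1r.
split; last 1 first.
- exists 1%N, (fun=> 1) => s; have [r <-] := all_inR s.
  by exists (fun=> r); rewrite big_ord1 mulr1.
- exists 1%N, (fun _ _ => True) => T [TR _ _ _]; exists ord0 => x; split=> // _.
  by have [r <-] := all_inR x.
- by move=> b _ _.
Qed.

End Gluing.

Theorem theorem5p5 (R S : comNzRingType) (f : {rmorphism R -> S}) :
  injective f -> etale f ->
  ((FIP f /\ seminormal f /\ finite_ext f) <->
     (nucleus_artinian f /\ nucleus_reduced f)) /\
  ((FIP f /\ finite_ext f /\ nucleus_reduced f) <->
     (seminormal f /\ gilmer f)).
Proof.
move=> _ [_ _ unr]; split; split.
- move=> [fip [sn fin]]; have red := seminormal_nucleus_reduced sn.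
  by split=> //; exact: FIP_nucleus_artinian.
- by move=> [art red]; have [] := artinian_reduced_nucleus unr art red.
- move=> [fip [fin red]]; have art := FIP_nucleus_artinian fip fin red.
  by have [] := artinian_reduced_nucleus unr art red.
- move=> [sn art]; have red := seminormal_nucleus_reduced sn.
  by have [] := artinian_reduced_nucleus unr art red.
Qed.
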